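(* Let $n\in\mathbb{N}$ and let $e_1,\ldots,e_n$ be the standard basis of $\mathbb{R}^n$. Let $Z=(Z_1,\ldots,Z_n)$ be a random probability vector in $\mathbb{R}^n$ whose expectation vector $(p_1,\ldots,p_n):=\mathbb{E}Z$ forms a good probability measure on $\{1,\ldots,n\}$, that is, there exists $B\subseteq\{1,\ldots,n\}$ with $\sum_{i\in B}p_i\in(0,1)\setminus\{1/2\}$. Then $Z$ has a Dirichlet distribution if and only if there exists a $[0,1]$-valued random variable $W$, independent of $Z$, with $\mathbb{E}W\in(0,1)$ such that $$ \mathbb{E}\,g(Z)Z_i=p_i\,\mathbb{E}\,g((1-W)Z+We_i),\quad i=1,\ldots,n, $$ for all measurable $g\colon[0,1]^n\to[0,\infty)$. In this case $W$ has the $\mathrm{Beta}(1,\alpha)$ distribution and $Z$ has the $\mathrm{Dir}(\alpha p_1,\ldots,\alpha p_n)$ distribution, where $\alpha=(1-\mathbb{E}W)/\mathbb{E}W$.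
   Context: A random probability vector in $\mathbb{R}^n$ is a random element of $\Delta_n:=\{(p_1,\dots,p_n)\in[0,1]^n:p_1+\dots+p_n=1\}$. For $\alpha,\beta>0$, $\mathrm{Beta}(\alpha,\beta)$ is the probability measure on $[0,1]$ with Lebesgue density $x\mapsto B(\alpha,\beta)^{-1}x^{\alpha-1}(1-x)^{\beta-1}$, where $B(\alpha,\beta)=\Gamma(\alpha)\Gamma(\beta)/\Gamma(\alpha+\beta)$. Dirichlet distribution: for $n\ge 1$ and $\alpha_1,\dots,\alpha_n\in[0,\infty)$ with $\alpha_1+\cdots+\alpha_n>0$, $\mathrm{Dir}(\alpha_1,\dots,\alpha_n)$ is the probability measure on $\Delta_n$ defined as follows. If $n\ge 2$ and all $\alpha_i>0$, it has density $(x_1,\dots,x_n)\mapsto \frac{\Gamma(\alpha_1+\dots+\alpha_n)}{\Gamma(\alpha_1)\cdots\Gamma(\alpha_n)}x_1^{\alpha_1-1}\cdots x_n^{\alpha_n-1}$ with respect to Lebesgue measure on $\Delta_n$ (parametrized by the first $n-1$ coordinates). If $n=1$, $\mathrm{Dir}(\alpha_1):=\delta_1$. If $n\ge2$ and some of the $\alpha_i$ vanish, the corresponding coordinates are equal to $0$ and the remaining coordinates have the Dirichlet distribution with the remaining (positive) parameters. ''$Z$ has a Dirichlet distribution'' means that its law is $\mathrm{Dir}(\alpha_1,\dots,\alpha_n)$ for some such parameters. The existence of the independent random variable $W$ is understood up to enlarging the underlying probability space; equivalently, it is the existence of a probability measure (the law of $W$) on $[0,1]$ such that the identities hold with $(Z,W)$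 having the product law. *)

(* Defs.v *)
From HB Require Import structures.
From mathcomp Require Import all_boot all_order all_algebra.
From mathcomp Require Import all_classical all_reals all_analysis.

Set Implicit Arguments.
Unset Strict Implicit.
Unset Printing Implicit Defensive.

Import Order.TTheory GRing.Theory Num.Theory.
Import numFieldNormedType.Exports.

Local Open Scope classical_set_scope.
Local Open Scope ring_scope.

(* Vectors of R^n are tuples [n.-tuple R], whose library sigma-algebra is the
   one generated by the coordinates, i.e. the Borel sets of R^n. *)

Definition unit_cube (R : realType) (n : nat) : set (n.-tuple R) :=
  [set x | forall i, 0 <= tnth x i <= 1].

Definition stdsimplex (R : realType) (n : nat) : set (n.-tuple R) :=
  [set x | unit_cube x /\ \sum_(i < n) tnth x i = 1].

Section lebesgue_tuple.
Context {R : realType}.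
Local Open Scope ereal_scope.

Definition tuple_of_pair {m} (z : measurableTypeR R * m.-tuple R) : m.+1.-tuple R :=
  [tuple of z.1 :: z.2].

(* Lebesgue measure on R^m, as an iterated product measure. *)
Fixpoint lebesgue_tuple {m : nat} : set (m.-tuple R) -> \bar R :=
  match m with
  | 0 => \d_ [tuple]
  | m'.+1 => pushforward (lebesgue_measure \x @lebesgue_tuple m') tuple_of_pair
  end.

Lemma measurable_tuple_of_pair m :
  measurable_fun [set: (measurableTypeR R * m.-tuple R)%type] tuple_of_pair.
Proof. exact: measurable_cons. Qed.

Section pushforward_tuple.
Variables (m : nat).
Variable mu : {sigma_finite_measure set (m.-tuple R) -> \bar R}.

Let pr : {measure set (measurableTypeR R * m.-tuple R)%type -> \bar R} :=
  lebesgue_measure \x mu.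

Let nu := pushforward pr tuple_of_pair.

(* The library's own instance of this fact is shadowed by its instance for
   products of subprobabilities. *)
Let pr_sigma_finite : sigma_finite setT pr.
Proof.
have /sigma_finiteP[F [TF ndF Foo]] :=
  sigma_finiteT (@lebesgue_measure R : {sigma_finite_measure set _ -> \bar R}).
have /sigma_finiteP[G [TG ndG Goo]] := sigma_finiteT mu.
exists (fun n => F n `*` G n) => [|k].
  rewrite -setXTT TF TG predeqE => -[x y]; split.
    move=> [/= [n _ Fnx] [k _ Gky]]; exists (maxn n k) => //; split.
    - by move: x Fnx; exact/subsetPset/ndF/leq_maxl.
    - by move: y Gky; exact/subsetPset/ndG/leq_maxr.
  by move=> [n _ []/= ? ?]; split; exists n.
have [? ?] := Foo k; have [? ?] := Goo k.
split; first exact: measurableX.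
by rewrite /pr /= product_measure1E// lte_mul_pinfty// ge0_fin_numE.
Qed.

Let nu0 : nu set0 = 0. Proof. by rewrite /nu /pushforward preimage_set0 measure0. Qed.

Let nu_ge0 A : 0 <= nu A. Proof. by rewrite /nu /pushforward measure_ge0. Qed.

Let nu_sigma_additive : semi_sigma_additive nu.
Proof.
move=> F mF tF mUF; rewrite /nu /pushforward preimage_bigcup.
have mf A : measurable A -> measurable (@tuple_of_pair m @^-1` A).
  by move=> mA; rewrite -[X in measurable X]setTI; exact: measurable_tuple_of_pair.
apply: measure_semi_sigma_additive => [n||].
- exact: mf.
- apply/trivIsetP => /= i j _ _ ij; rewrite -preimage_setI.
  by move/trivIsetP : tF => /(_ _ _ _ _ ij) ->//; rewrite preimage_set0.
- by rewrite -preimage_bigcup; exact: mf.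
Qed.

HB.instance Definition _ := isMeasure.Build _ _ _ nu
  nu0 nu_ge0 nu_sigma_additive.

Let nu_sigma_finite : sigma_finite setT nu.
Proof.
have [F FT Ffin] := pr_sigma_finite.
pose g (x : m.+1.-tuple R) := (thead x, [tuple of behead x]).
have gK : cancel tuple_of_pair g.
  by case=> x t; congr pair; apply/val_inj.
have mg : measurable_fun setT g.
  apply/measurable_fun_pairP; split.
    exact: measurable_tnth.
  exact: measurable_behead.
exists (fun k => g @^-1` F k) => [|k].
  by rewrite -preimage_bigcup -FT preimage_setT.
have [mF muF] := Ffin k; split.
  by rewrite -[X in measurable X]setTI; exact: mg.
rewrite /nu /pushforward (_ : _ @^-1` _ = F k)//.
by apply/seteqP; split => z /=; rewrite gK.
Qed.

HB.instance Definition _ := Measure_isSigmaFinite.Build _ _ _ nu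
  nu_sigma_finite.

Definition pushforward_tuple :
  {sigma_finite_measure set (m.+1.-tuple R) -> \bar R} := nu.

End pushforward_tuple.

Lemma lebesgue_tuple_measureP m :
  exists mu : {sigma_finite_measure set (m.-tuple R) -> \bar R},
    @lebesgue_tuple m = mu.
Proof.
elim: m => [|m [mu muE]] /=.
  by exists (\d_ [tuple] : {finite_measure set _ -> \bar R}).
by rewrite muE; exists (pushforward_tuple mu).
Qed.

Section lebesgue_tuple_instances.
Variable m : nat.
Let leb : set (m.-tuple R) -> \bar R := lebesgue_tuple.

Let leb0 : leb set0 = 0.
Proof. by rewrite /leb; have [mu ->] := lebesgue_tuple_measureP m; rewrite measure0. Qed.

Let leb_ge0 A : 0 <= leb A.
Proof.
by rewrite /leb; have [mu ->] := lebesgue_tuple_measureP m; exact: measure_ge0.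
Qed.

Let leb_sigma_additive : semi_sigma_additive leb.
Proof.
rewrite /leb; have [mu ->] := lebesgue_tuple_measureP m.
exact: measure_semi_sigma_additive.
Qed.

Let leb_sigma_finite : sigma_finite setT leb.
Proof.
by rewrite /leb; have [mu ->] := lebesgue_tuple_measureP m; exact: sigma_finiteT.
Qed.

HB.instance Definition _ := isMeasure.Build _ _ _ (@lebesgue_tuple m)
  leb0 leb_ge0 leb_sigma_additive.

HB.instance Definition _ := Measure_isSigmaFinite.Build _ _ _
  (@lebesgue_tuple m) leb_sigma_finite.

End lebesgue_tuple_instances.

End lebesgue_tuple.

Section beta_dirichlet.
Context {R : realType}.

Definition gamma_fun (a : R) : R :=
  \int[lebesgue_measure]_(x in `]0, +oo[) (x `^ (a - 1) * expR (- x)).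

(* The library's [beta_fun] and [beta_prob] only take parameters in nat. *)
Definition euler_beta (a b : R) : R :=
  gamma_fun a * gamma_fun b / gamma_fun (a + b).

Definition beta_density (a b x : R) : R :=
  (euler_beta a b)^-1 * x `^ (a - 1) * (1 - x) `^ (b - 1).

Definition beta_law (a b : R) (A : set R) : \bar R :=
  (\int[lebesgue_measure]_(x in A `&` `[0%R, 1%R]) (beta_density a b x)%:E)%E.

Definition dirichlet_density k (a x : k.-tuple R) : R :=
  gamma_fun (\sum_(i < k) tnth a i) / (\prod_(i < k) gamma_fun (tnth a i)) *
  \prod_(i < k) tnth x i `^ (tnth a i - 1).

(* Parametrization of the hyperplane of coordinate sum 1 by all coordinates but
   the last one. *)
Definition simplex_chart m (x : m.-tuple R) : m.+1.-tuple R :=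
  [tuple of rcons x (1 - \sum_(i < m) tnth x i)].

(* Dirichlet law for positive parameters; the case k = 0 is a dummy value. *)
Definition dirichlet_pos k : k.-tuple R -> set (k.-tuple R) -> \bar R :=
  match k return k.-tuple R -> set (k.-tuple R) -> \bar R with
  | 0 => fun _ _ => 0%E
  | 1 => fun _ => \d_ ([tuple 1] : 1.-tuple R)
  | m.+2 => fun a A =>
      (\int[lebesgue_tuple]_(x in @simplex_chart m.+1 @^-1`
                                     (A `&` @stdsimplex R m.+2))
         (dirichlet_density a (simplex_chart x))%:E)%E
  end.

Definition pos_support n (a : n.-tuple R) : {set 'I_n} :=
  [set i | 0 < tnth a i].

(* The vector with coordinates y along S (in increasing order of the indices)
   and 0 outside S. *)
Definition pad_zeros n (S : {set 'I_n}) (y : #|S|.-tuple R) : n.-tuple R :=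
  [tuple \sum_(j < #|S| | enum_val j == i) tnth y j | i < n].

Definition dirichlet n (a : n.-tuple R) : set (n.-tuple R) -> \bar R :=
  let S := pos_support a in
  pushforward (dirichlet_pos [tuple tnth a (enum_val j) | j < #|S|])
              (@pad_zeros n S).

Definition dirichlet_parameter n (a : n.-tuple R) : Prop :=
  (forall i, 0 <= tnth a i) /\ 0 < \sum_(i < n) tnth a i.

End beta_dirichlet.

Section random_vectors.
Context {R : realType}.

Definition has_law d d' (T : measurableType d) (E : measurableType d')
    (P : probability T R) (X : {RV P >-> E}) (mu : set E -> \bar R) : Prop :=
  forall A, measurable A -> distribution P X A = mu A.

Definition has_dirichlet_law d (T : measurableType d) (P : probability T R) n
    (Z : {RV P >-> n.-tuple R}) : Prop :=
  exists2 a, dirichlet_parameter a & has_law Z (dirichlet a).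

Definition independent d d1 d2 (T : measurableType d) (E1 : measurableType d1)
    (E2 : measurableType d2) (P : probability T R) (X : T -> E1) (Y : T -> E2) :
    Prop :=
  forall A B, measurable A -> measurable B ->
    P (X @^-1` A `&` Y @^-1` B) = (P (X @^-1` A) * P (Y @^-1` B))%E.

Definition mean_vector d (T : measurableType d) (P : probability T R) n
    (Z : T -> n.-tuple R) : n.-tuple R :=
  [tuple fine ('E_P[fun t => tnth (Z t) i])%E | i < n].

Definition good n (p : n.-tuple R) : Prop :=
  exists B : {set 'I_n},
    0 < \sum_(i in B) tnth p i < 1 /\ \sum_(i in B) tnth p i != 1 / 2.

(* (1 - w) z + w e_i *)
Definition move_towards n (i : 'I_n) (w : R) (z : n.-tuple R) : n.-tuple R :=
  [tuple (1 - w) * tnth z j + w * (j == i)%:R | j < n].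

(* (T', Q, proj) is an enlargement of the probability space (T, P), on which Z is
   seen as [Z \o proj], and W is a random variable on it. *)
Definition size_bias_mixture d d' (T : measurableType d) (T' : measurableType d')
    (P : probability T R) (Q : probability T' R) n (Z : {RV P >-> n.-tuple R})
    (proj : {RV Q >-> T}) (W : {RV Q >-> R}) : Prop :=
  [/\ has_law proj P,
      forall t, 0 <= W t <= 1,
      independent Q (Z \o proj) W,
      (0 < 'E_Q[W] < 1)%E
    & forall (i : 'I_n) (g : n.-tuple R -> R),
        measurable_fun (@unit_cube R n) g ->
        (forall x, unit_cube x -> 0 <= g x) ->
        ('E_Q[fun t => (g (Z (proj t)) * tnth (Z (proj t)) i)%R] =
         (tnth (mean_vector P Z) i)%:E *
         'E_Q[fun t => g (move_towards i (W t) (Z (proj t)))])%E].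

End random_vectors.

(* Main.v *)
Require Import Defs.
From HB Require Import structures.
From mathcomp Require Import all_boot all_order all_algebra.
From mathcomp Require Import all_classical all_reals all_analysis.
From mathcomp Require Import measurable_realfun.
From mathcomp Require Import ring lra.

(** The identity only involves the laws of [Z] and [W], and all laws at hand are
    determined by their moments.

    Existence.  The moments of [Dir(a_1, ..., a_n)] and [Beta(1, alpha)],
    [alpha = a_1 + ... + a_n], are quotients of rising factorials, and the
    identity for monomials reduces to
    [a * sum_l k (k-1) ... (k-l+1) * a^(rising k-l) = a^(rising k+1)].

    Uniqueness.  For [X = sum_(i in B) Z_i], with mean [p], [q = 1 - p],
    [c_k = E (1 - W)^k], [m_k = E X^k] and [n_k = E (1 - X)^k], the identity gives
    [m_(k+1) = m_k (1 - q c_k)] and [n_(k+1) = n_k (1 - p c_k)].  Expanding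
    [(1 - X)^(k+1)] yields a linear equation for [c_k] with coefficient
    [p n_k + (-1)^k q m_k]; for [k >= 2] it does not vanish as [p <> 1/2].  Hence
    [c_1] determines all [c_k], and then the identity determines the mixed
    moments of [Z] by induction on the degree.  So [(Z, W)] has the same laws as
    the Dirichlet-beta solution with the same means. *)

Set Implicit Arguments.
Unset Strict Implicit.
Unset Printing Implicit Defensive.

Import Order.TTheory GRing.Theory Num.Theory.
Import numFieldNormedType.Exports.

Local Open Scope classical_set_scope.
Local Open Scope ring_scope.

(** * Densities and affine changes of variables *)

(** The coefficient of [c_k] vanishes at [k = 1], since [m_1 = p] and [n_1 = q]. This leaves [c_1]
    free and accounts for the parameter [alpha] of the solutions. For even [k >= 2] the coefficient
    is a sum of positive terms; for odd [k] it is a difference, whose sign is strict once [p <> q].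
    If [p = q = 1/2], the sequences [m] and [n] coincide and the coefficient is 0 at every odd [k];
    goodness of the mean vector excludes this.

    Moment determinacy rests on explicit polynomials tending to indicators of half-lines, used one
    coordinate at a time. It is proved for finite measures concentrated on the cube, so that it
    serves for the laws of [Z] and [1 - W] and also for the two sides of the identity, seen as
    measures integrating [g].

    Euler's integrals are taken in the extended reals, over the whole line, of kernels vanishing off
    the positive half-line, so that Tonelli and affine substitutions apply before finiteness is
    known. *)

Section pushforward_measure.
Context d d' (T : measurableType d) (T' : measurableType d') (R : realType).

(* The library's instance cannot be inferred, as it depends on [mf]. *)
Definition pushforward_measure (mu : {measure set T -> \bar R}) (f : T -> T')
    (mf : measurable_fun setT f) : {measure set T' -> \bar R} :=
  measure_function_pushforward__canonical__measure_function_Measure mu mf.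

End pushforward_measure.

Section density_measure.
Local Open Scope ereal_scope.
Context d (T : measurableType d) (R : realType).
Variables (mu : {measure set T -> \bar R}) (D : set T) (f : T -> R).
Hypotheses (mD : measurable D) (mf : measurable_fun D f).
Hypothesis f0 : forall x, D x -> (0 <= f x)%R.

(** The proofs are arguments of the definition so that the measure structure can be inferred from
    the term. *)
Definition mdensity of measurable D & measurable_fun D f &
  (forall x, D x -> (0 <= f x)%R) : set T -> \bar R :=
  fun A => \int[mu]_(x in A `&` D) (f x)%:E.

Local Notation nu := (mdensity mD mf f0).

Let nu0 : nu set0 = 0. Proof. by rewrite /mdensity set0I integral_set0. Qed.

Let nu_ge0 A : 0 <= nu A.
Proof. by apply: integral_ge0 => x [_ Dx]; rewrite lee_fin f0. Qed.

Let nu_sigma_additive : semi_sigma_additive nu.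
Proof.
move=> F mF tF mUF; rewrite /mdensity setI_bigcupl; apply: cvg_toP.
  apply: ereal_nondecreasing_is_cvgn => m n mn.
  by apply: lee_sum_nneg_natr => // k _ _; exact: nu_ge0.
rewrite ge0_integral_bigcup//=.
- by move=> k; exact: measurableI.
- by apply/measurable_EFinP; apply: measurable_funS mf => // x [k _ []].
- by move=> x [k _ [_ Dx]]; rewrite lee_fin f0.
- exact: trivIset_setIr.
Qed.

HB.instance Definition _ := isMeasure.Build _ _ _ nu
  nu0 nu_ge0 nu_sigma_additive.

Import HBNNSimple.

(** For indicators this is the definition of [mdensity]; linearity gives simple functions, and
    monotone convergence along [nnsfun_approx] the rest. *)
Lemma ge0_integral_mdensity E (g : T -> \bar R) :
  measurable E -> measurable_fun E g -> (forall x, E x -> 0 <= g x) ->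
  \int[nu]_(x in E) g x = \int[mu]_(x in E `&` D) (g x * (f x)%:E).
Proof.
move=> mE mg g0; have mED : measurable (E `&` D) by exact: measurableI.
have mfE : measurable_fun (E `&` D) f by exact: measurable_funS mf.
pose g_ := nnsfun_approx mE mg.
have g_E n A : \int[nu]_(x in A) (g_ n x)%:E = \int[nu]_(x in A)
      (\sum_(k \in range (g_ n)) (k * \1_(g_ n @^-1` [set k]) x)%:E).
  by apply: eq_integral => x _; rewrite fimfunE fsumEFin.
transitivity (limn (fun n => \int[nu]_(x in E) (g_ n x)%:E)).
  rewrite -monotone_convergence//.
  - by apply: eq_integral => y /[!inE] yE; apply/esym/cvg_lim => //;
      exact: cvg_nnsfun_approx.
  - by move=> n; exact/measurable_EFinP/measurable_funTS.
  - by move=> n y _; rewrite lee_fin.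
  - by move=> y _ m n mn; rewrite lee_fin; exact/lefP/nd_nnsfun_approx.
transitivity (limn (fun n => \int[mu]_(x in E `&` D) ((g_ n x * f x)%:E))).
  congr (limn _); apply/funext => n.
  rewrite g_E.
  rewrite ge0_integral_fsum//; last 2 first.
  - by move=> y; exact/measurable_EFinP/measurable_funM.
  - by move=> y x _; rewrite nnfun_muleindic_ge0.
  transitivity (\int[mu]_(x in E `&` D) (\sum_(k \in range (g_ n))
      ((k * \1_(g_ n @^-1` [set k]) x)%:E * (f x)%:E))); last first.
    apply: eq_integral => x _.
    rewrite EFinM [X in _ = X%:E * _]fimfunE -fsumEFin// ge0_mule_fsuml// => k;
      exact: nnfun_muleindic_ge0.
  rewrite ge0_integral_fsum//; last 2 first.
  - move=> k; apply: emeasurable_funM; last exact/measurable_EFinP.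
    exact/measurable_EFinP/measurable_funM.
  - move=> k x [_ Dx]; apply: mule_ge0; last by rewrite lee_fin f0.
    exact: nnfun_muleindic_ge0.
  apply: eq_fsbigr => k _.
  have mk : measurable (g_ n @^-1` [set k]) by [].
  rewrite integralZl_indic_nnsfun// integral_indic//=.
  under [RHS]eq_integral do rewrite EFinM -muleA.
  have [k0|k0] := ltP k 0%R.
    rewrite preimage_nnfun0// set0I measure0 mule0.
    by rewrite integral0_eq// => x _; rewrite indic0 mul0e mule0.
  rewrite ge0_integralZl//; last 2 first.
  - by apply: emeasurable_funM => //; exact/measurable_EFinP.
  - by move=> x [_ Dx]; rewrite mule_ge0// ?lee_fin// f0.
  congr (_ * _); rewrite /mdensity -setIA integral_mkcondl.
  by apply: eq_integral => x _; rewrite patchE indicE; case: ifPn => _; rewrite ?mul1e ?mul0e.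
rewrite -monotone_convergence//.
- apply: eq_integral => y /[!inE] -[yE yD]; apply/cvg_lim => //.
  under eq_fun do rewrite EFinM.
  by apply: cvgeZr => //; exact: cvg_nnsfun_approx.
- by move=> n; apply/measurable_EFinP/measurable_funM => //; exact/measurable_funTS.
- by move=> n y [_ Dy]; rewrite lee_fin mulr_ge0// f0.
- move=> y [_ Dy] m n mn; rewrite lee_fin ler_wpM2r ?f0//.
  exact/lefP/nd_nnsfun_approx.
Qed.

End density_measure.

Section lebesgue_affine.
Context (R : realType).
Local Open Scope ereal_scope.
Local Notation leb := (@lebesgue_measure R).

(** The image of Lebesgue measure under [x |-> c x + d], multiplied by [c], gives half-open
    intervals their length, hence is Lebesgue measure. *)
Lemma ge0_integral_affine (c d : R) (f : R -> \bar R) : (0 < c)%R ->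
  measurable_fun setT f -> (forall x, 0 <= f x) ->
  \int[leb]_x f x = c%:E * \int[leb]_x f (c * x + d)%R.
Proof.
move=> c0 mf f0.
pose phi (x : measurableTypeR R) : measurableTypeR R := (c * x + d)%R.
have mphi : measurable_fun setT phi.
  by apply: measurable_funD => //; exact: measurable_funM.
have c0' : (c != 0)%R by rewrite gt_eqF.
transitivity (\int[mscale (NngNum (ltW c0)) (pushforward_measure leb mphi)]_x f x).
  apply: eq_measure_integral => A mA _.
  apply: lebesgue_measure_unique => // _ [[a b] _ <-].
  have phiE : phi @^-1` `]a, b]%classic = `](a - d) / c, (b - d) / c]%classic%R.
    by apply/seteqP; split => x /=; rewrite !in_itv/= /phi ltr_pdivrMr//
      ler_pdivlMr// ltrBlDr lerBrDr mulrC.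
  suff : leb `]a, b] = c%:E * leb (phi @^-1` `]a, b]) by [].
  rewrite phiE.
  rewrite !lebesgue_measure_itv /= !lte_fin.
  rewrite ltr_pM2r ?invr_gt0// ltrD2r; case: ifPn => _; last by rewrite mule0.
  by rewrite -!EFinB -EFinM; congr EFin; field.
rewrite ge0_integral_mscale//; congr (_ * _).
exact: (ge0_integral_pushforward mphi).
Qed.

End lebesgue_affine.

(** * Euler's integrals *)

Section power_kernel.
Context (R : realType).
Local Notation leb := (@lebesgue_measure R).
Implicit Types a b s x : R.

(** The cut-off at 0 lets all integrals run over the whole line, so that translations and
    convolutions need no change of domain. *)
Definition pkern a x : R := if 0 < x then x `^ (a - 1) else 0.

Lemma pkern_ge0 a x : 0 <= pkern a x.
Proof. by rewrite /pkern; case: ifP => // _; exact: powR_ge0. Qed.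

Lemma pkern_le0 a x : x <= 0 -> pkern a x = 0.
Proof. by rewrite /pkern ltNge => ->. Qed.

Lemma measurable_pkern a : measurable_fun setT (pkern a).
Proof.
apply: measurable_fun_if => //.
- exact: measurable_fun_ltr.
- by apply: measurable_funTS; exact: measurable_powR.
Qed.

(** This turns moments of a law into its normalizing integral at shifted parameters. *)
Lemma pkern_exp a (k : nat) x : x ^+ k * pkern a x = pkern (a + k%:R) x.
Proof.
rewrite /pkern; case: ifPn => [x0|_]; last by rewrite mulr0.
rewrite -powR_mulrn ?ltW// -powRD; last by rewrite (gt_eqF x0) implybT.
by congr (_ `^ _); ring.
Qed.

Lemma pkernZ a s x : 0 < s -> pkern a (s * x) = s `^ (a - 1) * pkern a x.
Proof.
move=> s0; rewrite /pkern pmulr_rgt0//; case: ifPn => [x0|_]; last by rewrite mulr0.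
by rewrite powRM// ltW.
Qed.

Local Open Scope ereal_scope.

Definition beta_integral a b : \bar R :=
  \int[leb]_x (pkern a x * pkern b (1 - x))%:E.

(** Substituting [s x] for [x] pulls out the power [(a - 1) + (b - 1) + 1] of [s]. For [s <= 0] both
    sides vanish, as [x] and [s - x] are never both positive. *)
Lemma conv_pkern a b s :
  \int[leb]_x (pkern a x * pkern b (s - x))%:E =
  (pkern (a + b) s)%:E * beta_integral a b.
Proof.
have [s0|s0] := ltP 0%R s; last first.
  rewrite pkern_le0// mul0e integral0_eq// => x _.
  have [x0|x0] := ltP 0%R x; last by rewrite pkern_le0// mul0r.
  rewrite (@pkern_le0 b) ?mulr0//; lra.
have mk c d : measurable_fun setT (fun x : R => pkern a (c * x) * pkern b (d - c * x))%R.
  apply: measurable_funM.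
    by apply: (measurableT_comp (measurable_pkern a)); exact: measurable_funM.
  apply: (measurableT_comp (measurable_pkern b)).
  by apply: measurable_funB => //; exact: measurable_funM.
rewrite (@ge0_integral_affine _ s 0%R)//; last 2 first.
- apply/measurable_EFinP; have := mk 1%R s.
  by under eq_fun do rewrite mul1r.
- by move=> x; rewrite lee_fin mulr_ge0// pkern_ge0.
under eq_integral => x _.
  rewrite addr0 (_ : s - s * x = s * (1 - x))%R; last by ring.
  rewrite !pkernZ// mulrACA EFinM.
  over.
rewrite ge0_integralZl//; last 3 first.
- apply/measurable_EFinP; have := mk 1%R 1%R.
  by under eq_fun do rewrite mul1r.
- by move=> x _; rewrite lee_fin mulr_ge0// pkern_ge0.
- by rewrite lee_fin mulr_ge0// powR_ge0.
rewrite muleA -EFinM; congr (_%:E * _).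
rewrite /pkern s0 -[X in (X * _)%R]powRr1 ?ltW//.
rewrite -!powRD ?(gt_eqF s0) ?implybT//.
by congr (_ `^ _)%R; ring.
Qed.

Definition gamma_integral a : \bar R := \int[leb]_x (pkern a x * expR (- x))%:E.

Lemma gamma_integral_ge0 a : 0 <= gamma_integral a.
Proof. by apply: integral_ge0 => x _; rewrite lee_fin mulr_ge0 ?pkern_ge0 ?expR_ge0. Qed.

Lemma beta_integral_ge0 a b : 0 <= beta_integral a b.
Proof. by apply: integral_ge0 => x _; rewrite lee_fin mulr_ge0 ?pkern_ge0. Qed.

Let mexpRN : measurable_fun setT (fun x : R => expR (- x)).
Proof. exact: measurableT_comp. Qed.

(** In the double integral, take the sum of the two variables as the new second variable. After
    exchanging the integrals, the inner one is a convolution of power kernels. *)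
Lemma gamma_integralM a b :
  gamma_integral a * gamma_integral b = beta_integral a b * gamma_integral (a + b).
Proof.
have mg c : measurable_fun setT (fun x : R => (pkern c x * expR (- x))%:E).
  by apply/measurable_EFinP/measurable_funM => //; exact: measurable_pkern.
have g0 c (x : R) : 0 <= (pkern c x * expR (- x))%:E.
  by rewrite lee_fin mulr_ge0 ?pkern_ge0 ?expR_ge0.
(* [z.1] is the first variable and [z.2] the sum of both. *)
pose h (z : measurableTypeR R * measurableTypeR R) : \bar R :=
  (pkern a z.1 * pkern b (z.2 - z.1) * expR (- z.2))%:E.
have mh : measurable_fun setT h.
  apply/measurable_EFinP/measurable_funM; first apply: measurable_funM.
  - exact: (measurableT_comp (measurable_pkern a)).
  - apply: (measurableT_comp (measurable_pkern b)); exact: measurable_funB.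
  - exact: (measurableT_comp mexpRN).
have h0 z : 0 <= h z by rewrite lee_fin !mulr_ge0 ?pkern_ge0 ?expR_ge0.
transitivity (\int[leb]_x \int[leb]_y h (x, y)).
  rewrite -ge0_integralZr//; last 2 first.
  - exact: mg.
  - exact: gamma_integral_ge0.
  apply: eq_integral => x _.
  have -> : gamma_integral b =
      \int[leb]_y (pkern b (1 * y + - x) * expR (- (1 * y + - x)))%:E.
    by rewrite -[RHS]mul1e; exact: (ge0_integral_affine _ ltr01 (mg b) (g0 b)).
  rewrite -ge0_integralZl//; last first.
    apply: (measurableT_comp (mg b)); apply: measurable_funD => //.
  apply: eq_integral => y _; rewrite -EFinM; congr EFin.
  by rewrite /= mul1r mulrACA -expRD; congr (_ * expR _)%R; ring.
transitivity (\int[leb]_y \int[leb]_x h (x, y)).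
  exact: (@fubini_tonelli _ _ _ _ _ leb leb h mh h0).
rewrite muleC -ge0_integralZr//; last 2 first.
- exact: mg.
- exact: beta_integral_ge0.
apply: eq_integral => y _; rewrite EFinM muleAC -conv_pkern.
rewrite -ge0_integralZr//.
- apply/measurable_EFinP; apply: measurable_funM; first exact: measurable_pkern.
  by apply: (measurableT_comp (measurable_pkern b)); exact: measurable_funB.
- by move=> x _; rewrite lee_fin mulr_ge0// pkern_ge0.
Qed.

End power_kernel.

Section gamma_function.
Context (R : realType).
Local Notation leb := (@lebesgue_measure R).
Implicit Types a b s x : R.
Local Open Scope ereal_scope.

Lemma beta_integral1 a : (0 < a)%R -> beta_integral a 1 = (a^-1)%:E.
Proof.
(* The integrand may blow up at 0, so []0, 1]] is exhausted by compact intervals on which the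
   fundamental theorem of calculus applies; [n.+2] keeps the left end strictly below 1. *)
move=> a0; pose F (n : nat) : set R := `[(n.+2%:R^-1)%R, 1%R]%classic.
pose f (x : R) : \bar R := (x `^ (a - 1))%R%:E.
have FE : \bigcup_n F n = `]0%R, 1%R]%classic.
  apply/seteqP; split => x /=.
    move=> [n _]; rewrite /F/= !in_itv/= => /andP[nx ->]; rewrite andbT.
    by rewrite (lt_le_trans _ nx)// invr_gt0.
  rewrite in_itv/= => /andP[x0 x1].
  have [n nx] := ltr_add_invr x0; rewrite add0r in nx.
  exists n => //; rewrite /F/= in_itv/= x1 andbT (le_trans _ (ltW nx))//.
  by rewrite lef_pV2 ?posrE// ler_nat.
have Fint n : \int[leb]_(x in F n) f x = (a^-1 - a^-1 * n.+2%:R^-1 `^ a)%R%:E.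
  have n1 : (n.+2%:R^-1 < 1 :> R)%R by rewrite invf_lt1// ltr1n.
  have n0 : (0 < n.+2%:R^-1 :> R)%R by rewrite invr_gt0.
  have dF (x : R) : (0 < x)%R -> derivable (fun x => a^-1 * x `^ a)%R x 1.
    move=> x0; apply: derivableM => //.
    by apply: derivable_powR; rewrite in_itv/= x0.
  have dp (x r : R) : (0 < x)%R -> derivable (fun x => x `^ r)%R x 1.
    by move=> x0; apply: derivable_powR; rewrite in_itv/= x0.
  rewrite (@continuous_FTC2 _ (fun x => x `^ (a - 1))%R (fun x => a^-1 * x `^ a)%R)//.
  - by rewrite powR1 mulr1 -EFinB.
  - apply: derivable_within_continuous => x; rewrite in_itv/= => /andP[nx _].
    by apply: dp; exact: lt_le_trans nx.
  - split.
    + move=> x; rewrite in_itv/= => /andP[nx _].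
      by apply: dF; exact: lt_trans nx.
    + apply: cvg_at_right_filter.
      by have /derivable1_diffP/differentiable_continuous := dF _ n0.
    + apply: cvg_at_left_filter.
      by have /derivable1_diffP/differentiable_continuous := dF _ ltr01.
  - move=> x; rewrite in_itv/= => /andP[nx _].
    have x0 : (0 < x)%R by exact: lt_trans nx.
    rewrite derive1E deriveZ/=; last exact: dp.
    rewrite -derive1E powR_derive1 ?in_itv/= ?x0// /GRing.scale/=.
    by field; rewrite gt_eqF.
transitivity (\int[leb]_(x in `]0%R, 1%R]) f x).
  rewrite -integral_itv_bndo_bndc; last first.
    by apply/measurable_EFinP/measurable_funTS; exact: measurable_powR.
  rewrite [RHS]integral_mkcond /beta_integral; apply: eq_integral => x _.
  rewrite patchE /pkern subr_gt0 subrr powRr0; case: ifPn; case: ifPn => x1 //.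
  - move=> x0; case: ifPn; rewrite ?inE ?notin_setE/= in_itv/= x0 x1 ?mulr1//.
  - move=> x0; rewrite mulr0; case: ifPn => //; rewrite inE/= in_itv/= x0.
    by rewrite (negbTE x1).
  - move=> x0; rewrite mul0r; case: ifPn => //; rewrite inE/= in_itv/=.
    by rewrite (negbTE x0).
  - move=> x0; rewrite mul0r; case: ifPn => //; rewrite inE/= in_itv/=.
    by rewrite (negbTE x0).
have cF : \int[leb]_(x in F n) f x @[n --> \oo] --> \int[leb]_(x in \bigcup_n F n) f x.
  apply: ge0_nondecreasing_set_cvg_integral => //.
  - move=> n m nm; rewrite subsetEset => x; rewrite /F/= !in_itv/= => /andP[nx ->].
    by rewrite andbT (le_trans _ nx)// lef_pV2 ?posrE// ler_nat !ltnS.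
  - by move=> i; exact: measurable_itv.
  - by move=> i; apply/measurable_EFinP/measurable_funTS; exact: measurable_powR.
  - by move=> i x _; rewrite lee_fin powR_ge0.
rewrite -FE; apply: (cvg_unique _ cF) => //.
rewrite /= (funext Fint).
apply: cvg_EFin; first exact: nearW.
rewrite -[X in _ --> X]subr0; apply: cvgB; first exact: cvg_cst.
rewrite -[X in _ --> X](mulr0 (a^-1)%R); apply: cvgM; first exact: cvg_cst.
have /cvg_at_rightP := powR_cvg0 a0.
apply; split=> [n|]; first by rewrite invr_gt0.
have := @cvg_harmonic R; rewrite -(cvg_shiftS (harmonic : R ^nat)).
by apply.
Qed.

(** Up to the endpoint 0, the integrand is the density of the exponential law of rate 1. *)
Lemma gamma_integral1 : gamma_integral (1 : R) = 1.
Proof.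
rewrite -(@integral_exponential_pdf R 1%R)//.
rewrite /gamma_integral.
transitivity (\int[leb]_(x in `]0%R, +oo[) (expR (- x))%:E).
  rewrite [RHS]integral_mkcond; apply: eq_integral => x _.
  rewrite patchE /pkern; case: ifPn => x0.
    by rewrite mem_set ?subrr ?powRr0 ?mul1r//= in_itv/= x0.
  by rewrite memNset ?mul0r//= in_itv/= andbT; exact/negP.
rewrite integral_itv_obnd_cbnd; last first.
  by apply/measurable_EFinP/measurable_funTS; exact: measurableT_comp.
rewrite integral_mkcond; apply: eq_integral => x _.
rewrite /exponential_pdf !patchE; case: ifPn => // _.
by rewrite mul1r mulN1r.
Qed.

(** The product formula with [b = 1] replaces integration by parts. *)
Lemma gamma_integralS a : (0 < a)%R -> gamma_integral (a + 1) = a%:E * gamma_integral a.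
Proof.
move=> a0; have := gamma_integralM a 1.
rewrite gamma_integral1 mule1 beta_integral1// => ->.
by rewrite muleA -EFinM divff ?mul1e ?gt_eqF.
Qed.

Lemma gamma_integral_lty a : (0 < a)%R -> gamma_integral a < +oo.
Proof.
suff H : forall n a, (0 < a <= n.+1%:R)%R -> gamma_integral a < +oo.
  move=> a0; have [n an] : exists n, (a <= n.+1%:R)%R.
    by exists (Num.truncn a); rewrite ltW// truncnS_gt.
  by apply: (H n); rewrite a0.
elim => [|n IH] {}a /andP[a0 an].
  (* For [a <= 1] the integrand is at most [x^(a-1)] on []0, 1[] and at most [exp(-x)] beyond 1;
     larger [a] are reached by the functional equation. *)
  apply: (@le_lt_trans _ _ (beta_integral a 1 + gamma_integral 1)); last first.
    by rewrite beta_integral1// gamma_integral1 -EFinD ltry.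
  rewrite /beta_integral /gamma_integral -ge0_integralD//; last 4 first.
  - by move=> x _; rewrite lee_fin mulr_ge0 ?pkern_ge0.
  - apply/measurable_EFinP/measurable_funM; first exact: measurable_pkern.
    by apply: (measurableT_comp (measurable_pkern 1)); exact: measurable_funB.
  - by move=> x _; rewrite lee_fin mulr_ge0 ?pkern_ge0 ?expR_ge0.
  - apply/measurable_EFinP/measurable_funM; first exact: measurable_pkern.
    exact: measurableT_comp.
  apply: ge0_le_integral => //.
  - by move=> x _; rewrite lee_fin mulr_ge0 ?pkern_ge0 ?expR_ge0.
  - apply/measurable_EFinP/measurable_funM; first exact: measurable_pkern.
    exact: measurableT_comp.
  - apply/measurable_EFinP/measurable_funD; apply/measurable_funM; try exact: measurable_pkern.
      by apply: (measurableT_comp (measurable_pkern 1)); exact: measurable_funB.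
    exact: measurableT_comp.
  move=> x _; rewrite -EFinD lee_fin /pkern.
  have [x0|x0] := ltP 0%R x; last by rewrite !mul0r addr0.
  rewrite subrr !powRr0 mul1r subr_gt0.
  have [x1|x1] := ltP x 1%R.
    rewrite mulr1 (@le_trans _ _ (x `^ (a - 1)))%R//.
      by rewrite ler_piMr ?powR_ge0// -expR0 ler_expR oppr_le0 ltW.
    by rewrite lerDl expR_ge0.
  rewrite mulr0 add0r ler_piMl ?expR_ge0//.
  rewrite -[leRHS](powRr0 x) ler_powR// subr_le0//.
have [a1|a1] := leP a 1%R.
  by apply: IH; rewrite a0 (le_trans a1)// ler1n.
rewrite -[a](subrK 1%R) gamma_integralS ?subr_gt0//.
rewrite lte_mul_pinfty ?lee_fin ?subr_ge0 ?ltW//.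
by apply: IH; rewrite subr_gt0 a1/= lerBlDr natr1.
Qed.

Lemma gamma_funE a : (0 < a)%R -> (gamma_fun a)%:E = gamma_integral a.
Proof.
move=> a0; rewrite /gamma_fun /Rintegral.
rewrite [X in fine X](_ : _ = gamma_integral a).
  by rewrite fineK// ge0_fin_numE ?gamma_integral_lty// gamma_integral_ge0.
rewrite integral_mkcond; apply: eq_integral => x _.
rewrite patchE /pkern; case: ifPn; rewrite ?inE ?notin_setE/= in_itv/= andbT.
  by move=> ->.
by move=> /negP/negbTE ->; rewrite mul0r.
Qed.

#[local] Opaque gamma_fun.

Lemma gamma_fun_gt0 a : (0 < a)%R -> (0 < gamma_fun a)%R.
Proof.
move=> a0; rewrite -lte_fin gamma_funE//.
(* On [[1, 2]] both [ln x] and [x] are at most 2, so [c] bounds the integrand from below. *)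
pose c := expR (- (`|a - 1| * 2 + 2))%R.
apply: (@lt_le_trans _ _ (\int[leb]_(x in `[1%R, 2%R]) (cst c%:E x))).
  rewrite integral_cst//= lebesgue_measure_itv/= lte_fin ltr1n -EFinM lte_fin.
  by rewrite mulr_gt0 ?expR_gt0//; lra.
rewrite integral_mkcond; apply: ge0_le_integral => //.
- by move=> x _; rewrite patchE; case: ifPn => // _; rewrite lee_fin expR_ge0.
- apply/(measurable_restrictT _ _).1 => //.
- apply/measurable_EFinP/measurable_funM; first exact: measurable_pkern.
  exact: measurableT_comp.
move=> x _; rewrite patchE; case: ifPn; last first.
  by move=> _; rewrite lee_fin mulr_ge0 ?pkern_ge0 ?expR_ge0.
rewrite inE/= in_itv/= => /andP[x1 x2]; rewrite lee_fin.
have x0 : (0 < x)%R by lra.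
rewrite /pkern x0 /powR gt_eqF// -expRD ler_expR.
have lx0 : (0 <= ln x)%R by rewrite ln_ge0.
have lx2 : (ln x <= 2)%R by rewrite (le_trans (ltW (ln_sublinear x0))).
have : (`|a - 1| * ln x <= `|a - 1| * 2)%R by rewrite ler_wpM2l.
have : (- `|a - 1| * ln x <= (a - 1) * ln x)%R.
  by rewrite ler_wpM2r// lerNl -normrN ler_norm.
lra.
Qed.

Lemma gamma_funS a : (0 < a)%R -> gamma_fun (a + 1) = (a * gamma_fun a)%R.
Proof.
by move=> a0; apply: EFin_inj; rewrite EFinM !gamma_funE ?gamma_integralS// addr_gt0.
Qed.

Lemma beta_integralE a b : (0 < a)%R -> (0 < b)%R ->
  beta_integral a b = (euler_beta a b)%:E.
Proof.
move=> a0 b0; have ab0 : (0 < a + b)%R by rewrite addr_gt0.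
have := gamma_integralM a b; rewrite -!gamma_funE//.
have g0 := gamma_fun_gt0 ab0.
move=> /(congr1 (fun x : \bar R => x * ((gamma_fun (a + b))^-1)%:E)).
by rewrite -[RHS]muleA -!EFinM divff ?gt_eqF// mule1 => <-.
Qed.

End gamma_function.

(** * Beta laws *)

Section unit_mass_measure.
Local Open Scope ereal_scope.
Context d (T : measurableType d) (R : realType).
Variables (mu : {measure set T -> \bar R}) (mu1 : mu setT = 1).

(** An alias of [mu] carrying the proof of unit mass, to which the probability structure can be
    attached. *)
Definition unit_mass of mu setT = 1 : set T -> \bar R := mu.

HB.instance Definition _ := Measure.copy (unit_mass mu1) mu.

HB.instance Definition _ :=
  Measure_isProbability.Build _ _ _ (unit_mass mu1) mu1.

Lemma measure_probability : exists P : probability T R, forall A, P A = mu A.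
Proof. by exists (unit_mass mu1). Qed.

End unit_mass_measure.

Section measure_tools.
Local Open Scope ereal_scope.

(** The two exceptional points will be the ends 0 and [s] of a convolution, where the closed and
    open power kernels differ. *)
Lemma ge0_eq_integral_off2 (R : realType) (f g : R -> \bar R) (p q : R) :
  measurable_fun setT f -> measurable_fun setT g ->
  (forall x, 0 <= f x) -> (forall x, 0 <= g x) ->
  (forall x, x != p -> x != q -> f x = g x) ->
  \int[lebesgue_measure]_x f x = \int[lebesgue_measure]_x g x.
Proof.
move=> mf mg f0 g0 fg; apply: ge0_ae_eq_integral => //.
exists [set p; q]; split.
- exact: measurableU.
- by apply: countable_lebesgue_measure0; apply: finite_set_countable; exact: finite_set2.
- move=> x /= nfg; have [->|xp] := eqVneq x p; first by left.
  have [->|xq] := eqVneq x q; first by right.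
  by exfalso; apply: nfg => _; exact: fg.
Qed.

End measure_tools.

(** * Rising factorials and the moments of beta laws *)

Section rising.
Context (R : realType).
Implicit Types a : R.

Definition rising a (k : nat) : R := \prod_(i < k) (a + i%:R).

Lemma rising0 a : rising a 0 = 1. Proof. by rewrite /rising big_ord0. Qed.

Lemma risingS a k : rising a k.+1 = rising a k * (a + k%:R).
Proof. by rewrite /rising big_ord_recr. Qed.

(** Thanks to this value, the moment formula for Dirichlet laws also covers vanishing parameters. *)
Lemma rising0l k : rising 0 k = (k == 0)%:R.
Proof. by case: k => [|k]; rewrite ?rising0// /rising big_ord_recl addr0 mul0r. Qed.

Lemma rising_gt0 a k : 0 < a -> 0 < rising a k.
Proof. by move=> a0; apply: prodr_gt0 => i _; rewrite ltr_wpDr. Qed.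

Lemma gamma_fun_rising a k : 0 < a -> gamma_fun (a + k%:R) = rising a k * gamma_fun a.
Proof.
move=> a0; elim: k => [|k IH]; first by rewrite addr0 rising0 mul1r.
rewrite -natr1 addrA gamma_funS ?ltr_wpDr// IH risingS; ring.
Qed.

End rising.

Section beta_moments.
Context (R : realType).
Local Open Scope ereal_scope.
Local Notation leb := (@lebesgue_measure R).

(** The factor [w^l (1-w)^r] turns the density into an unnormalized one with parameters [a + l],
    [b + r]; the quotient of beta functions is one of rising factorials. *)
Lemma beta_law_moments (a b : R) : (0 < a)%R -> (0 < b)%R ->
  exists K : probability R R,
    [/\ forall A, measurable A -> K A = beta_law a b A,
        K `[0%R, 1%R]%classic = 1 &
        forall l r : nat, \int[K]_(w in `[0%R, 1%R]) (w ^+ l * (1 - w) ^+ r)%:E =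
          (rising a l * rising b r / rising (a + b) (l + r))%:E].
Proof.
move=> a0 b0; have ab0 : (0 < a + b)%R by rewrite addr_gt0.
pose D : set R := `[0%R, 1%R]%classic.
have mD : measurable D by exact: measurable_itv.
have mf : measurable_fun D (beta_density a b).
  apply: measurable_funM; first apply: measurable_funM => //.
    by apply: measurable_funTS; exact: measurable_powR.
  apply: measurable_funTS; apply: (measurableT_comp (@measurable_powR R _)).
  exact: measurable_funB.
have eb0 : (0 < euler_beta a b)%R by rewrite divr_gt0 ?mulr_gt0 ?gamma_fun_gt0.
have f0 x : D x -> (0 <= beta_density a b x)%R.
  by move=> _; rewrite !mulr_ge0 ?powR_ge0// invr_ge0 ltW.
(* Lebesgue measure lives on [measurableTypeR R]; the identity transports the density measure to
   [R]. *)
have mid : measurable_fun setT (id : measurableTypeR R -> R) by [].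
pose K0 : {measure set R -> \bar R} :=
  pushforward_measure (mdensity leb mD mf f0 : {measure set (measurableTypeR R) -> \bar R}) mid.
have K0E A : K0 A = beta_law a b A by [].
have mpoly l r E : measurable_fun E (fun w : R => w ^+ l * (1 - w) ^+ r)%R.
  apply: measurable_funTS; apply: measurable_funM; first exact: measurable_funX.
  by apply: measurable_funX; exact: measurable_funB.
have poly0 l r w : D w -> (0 <= w ^+ l * (1 - w) ^+ r)%R.
  by rewrite /D/= in_itv/= => /andP[w0 w1]; rewrite mulr_ge0 ?exprn_ge0// subr_ge0.
have mom l r : \int[K0]_(w in D) (w ^+ l * (1 - w) ^+ r)%:E =
    (rising a l * rising b r / rising (a + b) (l + r))%:E.
  have mm : measurable_fun D (fun w : R => (w ^+ l * (1 - w) ^+ r)%:E).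
    by apply/measurable_EFinP; apply: mpoly.
  have m0 w : D w -> 0 <= (w ^+ l * (1 - w) ^+ r)%:E.
    by move=> Dw; rewrite lee_fin poly0.
  transitivity (\int[mdensity leb mD mf f0]_(w in D) (w ^+ l * (1 - w) ^+ r)%:E).
    by rewrite [LHS](ge0_integral_pushforward mid)// => w; rewrite inE => /m0.
  rewrite ge0_integral_mdensity//.
  rewrite setIid [LHS](@integral_itv_bndoo _ _ _ _ true false); last first.
    apply: emeasurable_funM; apply/measurable_EFinP; first exact: mpoly.
    by apply: (measurable_funS mD _ mf) => x /=; exact: subset_itv_oo_cc.
  transitivity ((euler_beta a b)^-1%:E * beta_integral (a + l%:R) (b + r%:R)).
    have mk : measurable_fun setT (fun x : R => pkern (a + l%:R) x * pkern (b + r%:R) (1 - x))%R.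
      apply/measurable_funM; first exact: measurable_pkern.
      by apply: (measurableT_comp (measurable_pkern _)); exact: measurable_funB.
    rewrite /beta_integral -ge0_integralZl//; last 3 first.
    - exact/measurable_EFinP.
    - by move=> x _; rewrite lee_fin mulr_ge0 ?pkern_ge0.
    - by rewrite lee_fin invr_ge0 ltW.
    rewrite [LHS]integral_mkcond; apply: eq_integral => x _.
    rewrite patchE -!pkern_exp /pkern subr_gt0; case: ifPn.
      rewrite inE/= in_itv/= => /andP[-> ->]; rewrite -!EFinM /beta_density.
      by congr EFin; ring.
    rewrite notin_setE/= in_itv/=.
    by case: ifPn => x0; case: ifPn => x1; rewrite ?mulr0 ?mul0r ?mule0.
  rewrite beta_integralE ?ltr_wpDr// -EFinM; congr EFin.
  rewrite /euler_beta (_ : (a + l%:R + (b + r%:R) = a + b + (l + r)%:R)%R); last first.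
    by rewrite natrD; ring.
  rewrite !gamma_fun_rising//.
  by field; rewrite !gt_eqF// ?gamma_fun_gt0// ?rising_gt0.
(* Unit mass is the moment with [l = r = 0]. *)
have KD : K0 D = 1.
  transitivity (\int[K0]_(w in D) (w ^+ 0 * (1 - w) ^+ 0)%:E).
    rewrite -[LHS]mul1e -integral_cst//; apply: eq_integral => w _.
    by rewrite !expr0 mulr1.
  by rewrite mom !rising0 mulr1 divr1.
have [|K KE] := @measure_probability _ _ _ K0.
  by rewrite -KD /K0/= /pushforward/= /mdensity setTI setIid.
exists K; split=> [A _|//|l r]; first by rewrite KE.
  by rewrite KE.
rewrite -mom; apply: eq_measure_integral => A _ _; exact: KE.
Qed.

End beta_moments.

(** * Dirichlet laws *)

Section dirichlet_integral.
Context (R : realType).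
Local Notation leb := (@lebesgue_measure R).

(* Unlike [pkern], this kernel charges 0: it describes the closed simplex. *)
Definition cpkern (a x : R) : R := if 0 <= x then x `^ (a - 1) else 0.

Lemma cpkern_ge0 a x : 0 <= cpkern a x.
Proof. by rewrite /cpkern; case: ifP => // _; exact: powR_ge0. Qed.

Lemma measurable_cpkern a : measurable_fun setT (cpkern a).
Proof.
apply: measurable_fun_if => //.
- exact: measurable_fun_ler.
- by apply: measurable_funTS; exact: measurable_powR.
Qed.

Lemma cpkernE a x : x != 0 -> cpkern a x = pkern a x.
Proof. by rewrite /cpkern /pkern le_eqVlt eq_sym => /negbTE ->. Qed.

(** At [x = 0] and [k > 0], the exponent [a + k - 1] is positive and both sides are 0. *)
Lemma cpkern_exp a (k : nat) x : 0 < a -> x ^+ k * cpkern a x = cpkern (a + k%:R) x.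
Proof.
move=> a0; have [x0|x0] := eqVneq x 0; last by rewrite !cpkernE// pkern_exp.
rewrite /cpkern x0 lexx; case: k => [|k]; first by rewrite expr0 mul1r addr0.
by rewrite expr0n mul0r powR0// -natr1 gt_eqF// addrA addrK ltr_wpDr.
Qed.

Local Open Scope ereal_scope.

(** The integrands of the open and closed kernels differ at most at 0 and [s]. At [s = 0] the left
    side is 0, whereas [cpkern (a + b) 0] is 1 when [a + b = 1]. *)
Lemma conv_cpkern a b s : s != 0%R ->
  \int[leb]_x (cpkern a x * cpkern b (s - x))%:E =
  (cpkern (a + b) s)%:E * beta_integral a b.
Proof.
move=> s0; rewrite cpkernE// -conv_pkern.
apply: (@ge0_eq_integral_off2 _ _ _ 0%R s).
- apply/measurable_EFinP/measurable_funM; first exact: measurable_cpkern.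
  by apply: (measurableT_comp (measurable_cpkern b)); exact: measurable_funB.
- apply/measurable_EFinP/measurable_funM; first exact: measurable_pkern.
  by apply: (measurableT_comp (measurable_pkern b)); exact: measurable_funB.
- by move=> x; rewrite lee_fin mulr_ge0 ?cpkern_ge0.
- by move=> x; rewrite lee_fin mulr_ge0 ?pkern_ge0.
- by move=> x x0 xs; rewrite !cpkernE// subr_eq0 eq_sym.
Qed.

(** The unnormalized Dirichlet density on the simplex of total mass [s], the last coordinate being
    eliminated. A free [s] is what the induction on the dimension requires. *)
Definition simplex_kernel m (a : 'I_m -> R) (b s : R) (x : m.-tuple R) : R :=
  ((\prod_(i < m) cpkern (a i) (tnth x i)) *
   cpkern b (s - \sum_(i < m) tnth x i))%R.

Lemma simplex_kernel_ge0 m a b s (x : m.-tuple R) : (0 <= simplex_kernel a b s x)%R.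
Proof. by rewrite mulr_ge0 ?cpkern_ge0// prodr_ge0// => i _; exact: cpkern_ge0. Qed.

Lemma measurable_simplex_kernel m (a : 'I_m -> R) b :
  measurable_fun setT (fun z : R * m.-tuple R => simplex_kernel a b z.1 z.2).
Proof.
have mt i : measurable_fun setT (fun z : R * m.-tuple R => tnth z.2 i).
  by apply: (measurableT_comp (@measurable_tnth _ _ _ i)).
apply: measurable_funM.
  apply: measurable_prod => i _; apply: (measurableT_comp (measurable_cpkern _)).
  exact: mt.
apply: (measurableT_comp (measurable_cpkern _)); apply: measurable_funB => //.
exact: measurable_sum.
Qed.

Lemma simplex_kernel_cons m (a : 'I_m.+1 -> R) b s x (y : m.-tuple R) :
  simplex_kernel a b s [tuple of x :: y] =
  (cpkern (a ord0) x * simplex_kernel (a \o lift ord0) b (s - x) y)%R.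
Proof.
rewrite /simplex_kernel !big_ord_recl tnth0 mulrA; congr (_ * _ * cpkern _ _)%R.
  by apply: eq_bigr => i _; rewrite tnthS.
by rewrite opprD addrA; congr (_ - _)%R; apply: eq_bigr => i _; rewrite tnthS.
Qed.

(** Dirichlet's integral. With the first coordinate fixed at [x], the others carry mass [s - x]; the
    induction hypothesis leaves a convolution of two power kernels in [x]. *)
Lemma integral_simplex_kernel m (a : 'I_m -> R) (b s : R) :
  (forall i, (0 < a i)%R) -> (0 < b)%R -> s != 0%R ->
  \int[lebesgue_tuple]_x (simplex_kernel a b s x)%:E =
  ((\prod_(i < m) gamma_fun (a i)) * gamma_fun b / gamma_fun (\sum_(i < m) a i + b)
   * cpkern (\sum_(i < m) a i + b) s)%R%:E.
Proof.
elim: m a b s => [|m IH] a b s a0 b0 s0.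
  rewrite integral_dirac//; last first.
    apply/measurable_EFinP; have := measurable_simplex_kernel a b.
    by move=> /measurable_fun_pair2; exact.
  rewrite diracT mul1e /simplex_kernel !big_ord0 subr0 add0r !mul1r divff ?mul1r//.
  by rewrite gt_eqF// gamma_fun_gt0.
have suma0 : (0 < \sum_(i < m) a (lift ord0 i) + b)%R.
  by rewrite ltr_pwDr// sumr_ge0// => i _; exact: ltW.
have mk1 : measurable_fun setT (simplex_kernel a b s).
  exact: (measurable_fun_pair2 s (measurable_simplex_kernel a b)).
pose f (z : measurableTypeR R * m.-tuple R) : \bar R :=
  (simplex_kernel a b s (tuple_of_pair z))%:E.
have f0 z : 0 <= f z by rewrite lee_fin simplex_kernel_ge0.
have mf : measurable_fun setT f.
  apply/measurable_EFinP; apply: (measurableT_comp mk1).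
  exact: measurable_tuple_of_pair.
pose nu : {measure set _ -> \bar R} := leb \x @lebesgue_tuple R m.
transitivity (\int[nu]_z f z).
  have mk2 : measurable_fun setT (fun x => (simplex_kernel a b s x)%:E).
    exact/measurable_EFinP.
  have k0 : {in setT, forall x, 0 <= (simplex_kernel a b s x)%:E}.
    by move=> x _; rewrite lee_fin simplex_kernel_ge0.
  exact: (ge0_integral_pushforward (@measurable_tuple_of_pair R m) nu
    measurableT mk2 k0).
transitivity (\int[leb]_x \int[lebesgue_tuple]_y f (x, y)).
  exact: (@fubini_tonelli1 _ _ _ _ _ leb (@lebesgue_tuple R m) f mf f0).
pose C := ((\prod_(i < m) gamma_fun (a (lift ord0 i))) * gamma_fun b /
  gamma_fun (\sum_(i < m) a (lift ord0 i) + b))%R.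
pose A := (\sum_(i < m) a (lift ord0 i) + b)%R.
have prod0 : (0 < \prod_(i < m) gamma_fun (a (lift ord0 i)))%R.
  by apply: prodr_gt0 => i _; exact: gamma_fun_gt0.
have C0 : (0 <= C)%R by rewrite ltW// divr_gt0 ?mulr_gt0 ?gamma_fun_gt0.
have mconv : measurable_fun setT (fun x : R => cpkern (a ord0) x * cpkern A (s - x))%R.
  apply/measurable_funM; first exact: measurable_cpkern.
  by apply: (measurableT_comp (measurable_cpkern _)); exact: measurable_funB.
have fE x y : f (x, y) = (cpkern (a ord0) x)%:E *
    (simplex_kernel (a \o lift ord0) b (s - x) y)%:E.
  by rewrite /f /tuple_of_pair/= simplex_kernel_cons EFinM.
transitivity (\int[leb]_x (C%:E * (cpkern (a ord0) x * cpkern A (s - x))%:E)).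
  (* The null set [x = s] is discarded because the induction hypothesis asks for [s - x != 0]. *)
  apply: (@ge0_eq_integral_off2 _ _ _ s s).
  - exact: (@measurable_fun_fubini_tonelli_F _ _ _ _ _ (@lebesgue_tuple R m) f mf f0).
  - by apply: emeasurable_funM => //; exact/measurable_EFinP.
  - by move=> x; apply: integral_ge0 => y _; exact: f0.
  - by move=> x; rewrite mule_ge0 ?lee_fin// mulr_ge0 ?cpkern_ge0.
  - move=> x xs _; under eq_integral do rewrite fE.
    rewrite ge0_integralZl//; last 3 first.
    + apply/measurable_EFinP.
      exact: (measurable_fun_pair2 (s - x)%R (measurable_simplex_kernel _ b)).
    + by move=> y _; rewrite lee_fin simplex_kernel_ge0.
    + by rewrite lee_fin cpkern_ge0.
    rewrite IH//; last 2 first.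
    + by move=> i; exact: a0.
    + by rewrite subr_eq0 eq_sym.
    rewrite -!EFinM; congr EFin.
    by rewrite /= -/C -/A; ring.
rewrite ge0_integralZl//; last 2 first.
- exact/measurable_EFinP.
- by move=> x _; rewrite lee_fin mulr_ge0 ?cpkern_ge0.
rewrite conv_cpkern// beta_integralE// -!EFinM; congr EFin.
rewrite !big_ord_recl -addrA -/A /C -/A /euler_beta.
by field; rewrite !gt_eqF// gamma_fun_gt0// addr_gt0.
Qed.

End dirichlet_integral.

Section simplex.
Context (R : realType).

Lemma measurable_unit_cube n : measurable (@unit_cube R n).
Proof.
rewrite (_ : @unit_cube R n =
  \bigcap_(i in [set: 'I_n]) ((@tnth n R)^~ i @^-1` `[0, 1]%classic)).
  apply: fin_bigcap_measurable => //.
  move=> i _; rewrite -[X in measurable X]setTI.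
  by apply: measurable_tnth => //; exact: measurable_itv.
apply/seteqP; split => x /=.
  by move=> x01 i _ /=; rewrite in_itv/=.
by move=> x01 i; have := x01 i Logic.I; rewrite /= in_itv/=.
Qed.

Lemma measurable_stdsimplex n : measurable (@stdsimplex R n).
Proof.
rewrite (_ : @stdsimplex R n = @unit_cube R n `&`
  (fun x => \sum_(i < n) tnth x i) @^-1` [set 1]); last by [].
apply: measurableI; first exact: measurable_unit_cube.
rewrite -[X in measurable X]setTI.
have ms : measurable_fun setT (fun x : n.-tuple R => \sum_(i < n) tnth x i).
  by apply: measurable_sum => i; exact: measurable_tnth.
by apply: ms.
Qed.

Definition monomial n (e : 'I_n -> nat) (x : n.-tuple R) : R :=
  \prod_(i < n) tnth x i ^+ e i.

Lemma measurable_monomial n (e : 'I_n -> nat) D : measurable_fun D (monomial e).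
Proof.
apply: measurable_funTS; apply: measurable_prod => i _; apply: measurable_funX.
exact: measurable_tnth.
Qed.

Lemma monomial_ge0 n e (x : n.-tuple R) : unit_cube x -> 0 <= monomial e x.
Proof.
by move=> x01; apply: prodr_ge0 => i _; rewrite exprn_ge0//; have /andP[] := x01 i.
Qed.

Lemma stdsimplexP n (x : n.-tuple R) :
  stdsimplex x <-> (forall i, 0 <= tnth x i) /\ \sum_(i < n) tnth x i = 1.
Proof.
split=> [[x01 x1]|[x0 x1]].
  by split => // i; have /andP[] := x01 i.
split => // i; rewrite x0/= -x1 (bigD1 i)//= lerDl.
by apply: sumr_ge0 => j _.
Qed.

End simplex.

Section dirichlet_moments.
Context (R : realType).

Lemma tnth_simplex_chart_widen m (x : m.-tuple R) (j : 'I_m) :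
  tnth (simplex_chart x) (widen_ord (leqnSn _) j) = tnth x j.
Proof. by rewrite !(tnth_nth 0)/= nth_rcons size_tuple ltn_ord. Qed.

Lemma tnth_simplex_chart_max m (x : m.-tuple R) :
  tnth (simplex_chart x) ord_max = 1 - \sum_(i < m) tnth x i.
Proof. by rewrite (tnth_nth 0)/= nth_rcons size_tuple ltnn eqxx. Qed.

Lemma measurable_simplex_chart m : measurable_fun setT (@simplex_chart R m).
Proof.
apply/measurable_fun_tnthP => i; have [->|im] := eqVneq i ord_max.
  rewrite (_ : _ \o _ = fun x => 1 - \sum_(i < m) tnth x i); last first.
    by apply/funext => x /=; rewrite tnth_simplex_chart_max.
  apply: measurable_funB => //; apply: measurable_sum => j.
  exact: measurable_tnth.
have im' : (i < m)%N by rewrite ltn_neqAle -ltnS ltn_ord andbT.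
rewrite (_ : _ \o _ = fun x => tnth x (Ordinal im')); last first.
  apply/funext => x /=; rewrite -[RHS]tnth_simplex_chart_widen.
  by congr (tnth _ _); exact: val_inj.
exact: measurable_tnth.
Qed.

Lemma measurable_dirichlet_density k (a : k.-tuple R) :
  measurable_fun setT (dirichlet_density a).
Proof.
apply: measurable_funM => //; apply: measurable_prod => i _.
apply: (measurableT_comp (@measurable_powR R _)); exact: measurable_tnth.
Qed.

(* Outside the simplex, some coordinate of the chart is negative. *)
Lemma dirichlet_density_kernel m (a : m.+1.-tuple R) (e : 'I_m.+1 -> nat)
    (x : m.-tuple R) : (forall i, 0 < tnth a i) ->
  ((fun x => monomial e (simplex_chart x) * dirichlet_density a (simplex_chart x))
     \_ (@simplex_chart R m @^-1` @stdsimplex R m.+1)) x =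
  gamma_fun (\sum_(i < m.+1) tnth a i) / (\prod_(i < m.+1) gamma_fun (tnth a i)) *
  simplex_kernel
    (fun i => tnth a (widen_ord (leqnSn _) i) + (e (widen_ord (leqnSn _) i))%:R)
    (tnth a ord_max + (e ord_max)%:R) 1 x.
Proof.
move=> a0; set y := simplex_chart x.
have sy1 : \sum_(i < m.+1) tnth y i = 1.
  rewrite big_ord_recr/= tnth_simplex_chart_max addrC.
  under eq_bigr do rewrite tnth_simplex_chart_widen.
  by rewrite subrK.
have -> : simplex_kernel
    (fun i => tnth a (widen_ord (leqnSn _) i) + (e (widen_ord (leqnSn _) i))%:R)
    (tnth a ord_max + (e ord_max)%:R) 1 x =
    \prod_(i < m.+1) (tnth y i ^+ e i * cpkern (tnth a i) (tnth y i)).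
  rewrite big_ord_recr/= cpkern_exp// tnth_simplex_chart_max; congr (_ * _).
  by apply: eq_bigr => i _; rewrite cpkern_exp// tnth_simplex_chart_widen.
rewrite patchE; case: ifPn.
  rewrite inE => /stdsimplexP[y0 _].
  rewrite /dirichlet_density mulrCA; congr (_ * _).
  rewrite /monomial -big_split/=; apply: eq_bigr => i _.
  by rewrite /cpkern y0.
rewrite notin_setE/= => /stdsimplexP nS.
have [i yi] : exists i, tnth y i < 0.
  apply: contrapT => /forallNP yN; apply: nS; split => // i.
  by rewrite leNgt; apply/negP; exact: yN.
by rewrite [X in _ * X](bigD1 i)//= /cpkern leNgt yi/= mulr0 mul0r mulr0.
Qed.
Local Open Scope ereal_scope.

(** A monomial with exponents [e] shifts the parameters from [a] to [a + e], so each moment is a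
    quotient of two normalizing constants. *)
Lemma dirichlet_pos_moments k (a : k.-tuple R) : (0 < k)%N ->
  (forall i, (0 < tnth a i)%R) ->
  exists mu : probability (k.-tuple R) R,
    [/\ forall A, measurable A -> mu A = dirichlet_pos a A,
        mu (@stdsimplex R k) = 1 &
        forall e, \int[mu]_(x in @stdsimplex R k) (monomial e x)%:E =
          ((\prod_(i < k) rising (tnth a i) (e i)) /
            rising (\sum_(i < k) tnth a i) (\sum_(i < k) e i))%:E].
Proof.
case: k a => [//|[|m]] a _ a0.
  (* For one coordinate the law is a point mass at 1, and the quotient of rising factorials has
     equal numerator and denominator. *)
  exists (\d_ ([tuple 1%R] : 1.-tuple R)).
  have S1 : @stdsimplex R 1 [tuple 1%R].
    by apply/stdsimplexP; rewrite big_ord1 tnth0; split => // i; rewrite ord1 tnth0.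
  split => //.
    by rewrite /= diracE mem_set.
  move=> e; rewrite integral_dirac//.
  - rewrite diracE mem_set// mul1e /monomial !big_ord1 tnth0 expr1n divff//.
    by rewrite gt_eqF// rising_gt0.
  - exact: measurable_stdsimplex.
  - by apply/measurable_EFinP; exact: measurable_monomial.
pose S := @stdsimplex R m.+2.
have mS : measurable S by exact: measurable_stdsimplex.
pose D := @simplex_chart R m.+1 @^-1` S.
have mchart := @measurable_simplex_chart m.+1.
have mD : measurable D by rewrite -[D]setTI; exact: mchart.
pose h x := dirichlet_density a (@simplex_chart R m.+1 x).
have mh : measurable_fun D h.
  apply: measurable_funTS; apply: (measurableT_comp _ mchart).
  exact: measurable_dirichlet_density.
have suma0 : (0 < \sum_(i < m.+2) tnth a i)%R.
  by rewrite big_ord_recl ltr_pwDl// sumr_ge0// => i _; exact: ltW.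
have pga0 : (0 < \prod_(i < m.+2) gamma_fun (tnth a i))%R.
  by apply: prodr_gt0 => i _; exact: gamma_fun_gt0.
have h0 x : D x -> (0 <= h x)%R.
  move=> _; rewrite mulr_ge0 ?divr_ge0 ?(ltW pga0) ?(ltW (gamma_fun_gt0 suma0))//.
  by rewrite prodr_ge0// => i _; exact: powR_ge0.
pose mu0 : {measure set (m.+2.-tuple R) -> \bar R} :=
  pushforward_measure (mdensity (@lebesgue_tuple R m.+1) mD mh h0) mchart.
have mu0E A : mu0 A = dirichlet_pos a A by [].
have mom e : \int[mu0]_(x in S) (monomial e x)%:E =
    ((\prod_(i < m.+2) rising (tnth a i) (e i)) /
      rising (\sum_(i < m.+2) tnth a i) (\sum_(i < m.+2) e i))%:E.
  transitivity (\int[mdensity (@lebesgue_tuple R m.+1) mD mh h0]_(x in D)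
      (monomial e (simplex_chart x))%:E).
    apply: (ge0_integral_pushforward mchart _ mS).
    - by apply/measurable_EFinP; exact: measurable_monomial.
    - by move=> x /[!inE] -[x01 _]; rewrite lee_fin monomial_ge0.
  have mm : measurable_fun D (fun x => (monomial e (simplex_chart x))%:E).
    apply/measurable_EFinP; apply: measurable_funTS.
    by apply: (measurableT_comp _ mchart); exact: measurable_monomial.
  rewrite ge0_integral_mdensity//; last first.
    by move=> x [x01 _]; rewrite lee_fin monomial_ge0.
  rewrite setIid.
  pose c := (gamma_fun (\sum_(i < m.+2) tnth a i) / \prod_(i < m.+2) gamma_fun (tnth a i))%R.
  pose a' (i : 'I_m.+1) := (tnth a (widen_ord (leqnSn _) i) +
    (e (widen_ord (leqnSn _) i))%:R)%R.
  pose b' := (tnth a ord_max + (e ord_max)%:R)%R.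
  have msk : measurable_fun setT (simplex_kernel a' b' 1).
    exact: (measurable_fun_pair2 (1%R : R) (measurable_simplex_kernel a' b')).
  transitivity (\int[lebesgue_tuple]_x (c%:E * (simplex_kernel a' b' 1 x)%:E)).
    rewrite [LHS]integral_mkcond; apply: eq_integral => x _.
    rewrite -EFinM -dirichlet_density_kernel// !patchE; case: ifPn => // _.
  rewrite ge0_integralZl//; last 3 first.
  - exact/measurable_EFinP.
  - by move=> x _; rewrite lee_fin simplex_kernel_ge0.
  - by rewrite lee_fin divr_ge0// ltW// gamma_fun_gt0.
  rewrite integral_simplex_kernel//; last 2 first.
  - by move=> i; rewrite ltr_wpDr.
  - by rewrite ltr_wpDr.
  have -> : (\sum_(i < m.+1) a' i + b' =
      \sum_(i < m.+2) tnth a i + (\sum_(i < m.+2) e i)%:R)%R.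
    by rewrite natr_sum -big_split/= [RHS]big_ord_recr.
  rewrite -EFinM; congr EFin; rewrite /cpkern ler01 powR1 mulr1.
  have -> : ((\prod_(i < m.+1) gamma_fun (a' i)) * gamma_fun b' =
     (\prod_(i < m.+2) rising (tnth a i) (e i)) * \prod_(i < m.+2) gamma_fun (tnth a i))%R.
    rewrite -big_split/= [RHS]big_ord_recr/= gamma_fun_rising//; congr (_ * _)%R.
    by apply: eq_bigr => i _; rewrite gamma_fun_rising.
  rewrite gamma_fun_rising// /c.
  by field; rewrite !gt_eqF// ?gamma_fun_gt0// rising_gt0.
(* Unit mass is the moment with all exponents 0. *)
have mu0S : mu0 S = 1.
  transitivity (\int[mu0]_(x in S) (monomial (fun=> 0%N) x)%:E).
    rewrite -[LHS]mul1e -integral_cst//; apply: eq_integral => x _.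
    by rewrite /monomial big1// => i _; rewrite expr0.
  rewrite mom [X in (X / _)%R]big1 => [|i _]; last by rewrite rising0.
  by rewrite big1_eq rising0 divr1.
have [|mu muE] := @measure_probability _ _ _ mu0.
  by rewrite -mu0S /mu0/= /pushforward/= /mdensity preimage_setT setTI setIid.
exists mu; split=> [A _||e]; first by rewrite muE.
  by rewrite muE.
by rewrite -mom; apply: eq_measure_integral => A _ _; exact: muE.
Qed.

End dirichlet_moments.

(** * Vanishing parameters *)

Section zero_parameters.
Context (R : realType) (n : nat).
Implicit Types S : {set 'I_n}.

Lemma tnth_pad_zeros_val S (y : #|S|.-tuple R) (j : 'I_#|S|) :
  tnth (pad_zeros y) (enum_val j) = tnth y j.
Proof.
rewrite tnth_mktuple (big_pred1 j)// => l /=.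
by rewrite (inj_eq enum_val_inj).
Qed.

Lemma tnth_pad_zeros0 S (y : #|S|.-tuple R) i :
  i \notin S -> tnth (pad_zeros y) i = 0.
Proof.
move=> iS; rewrite tnth_mktuple big_pred0// => j /=.
by apply: contraNF iS => /eqP <-; exact: enum_valP.
Qed.

Lemma measurable_pad_zeros S : measurable_fun setT (@pad_zeros R n S).
Proof.
apply/measurable_fun_tnthP => i.
rewrite (_ : _ \o _ = fun y : #|S|.-tuple R =>
    \sum_(j < #|S| | enum_val j == i) tnth y j); last first.
  by apply/funext => y /=; rewrite tnth_mktuple.
under eq_fun do rewrite big_mkcond/=.
apply: measurable_sum => j; case: (enum_val j == i) => //.
exact: measurable_tnth.
Qed.

Lemma stdsimplex_pad_zeros S (y : #|S|.-tuple R) :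
  stdsimplex (pad_zeros y) <-> stdsimplex y.
Proof.
have sumE : \sum_(i < n) tnth (pad_zeros y) i = \sum_(j < #|S|) tnth y j.
  rewrite (bigID (mem S))/= [X in _ + X]big1 ?addr0; last first.
    by move=> i iS; rewrite tnth_pad_zeros0.
  rewrite big_enum_val/=; apply: eq_bigr => j _.
  by rewrite tnth_pad_zeros_val.
split=> /stdsimplexP[y0 y1]; apply/stdsimplexP; rewrite sumE in y1 *; split => //.
  by move=> j; rewrite -tnth_pad_zeros_val.
move=> i; have [iS|iS] := boolP (i \in S); last by rewrite tnth_pad_zeros0.
have iE : enum_val (enum_rank_in iS i) = i := enum_rankK_in iS iS.
by rewrite -iE tnth_pad_zeros_val.
Qed.

Local Open Scope ereal_scope.

Lemma dirichlet_moments (a : n.-tuple R) : dirichlet_parameter a ->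
  exists mu : probability (n.-tuple R) R,
    [/\ forall A, measurable A -> mu A = dirichlet a A,
        mu (@stdsimplex R n) = 1 &
        forall e, \int[mu]_(x in @stdsimplex R n) (monomial e x)%:E =
          ((\prod_(i < n) rising (tnth a i) (e i)) /
            rising (\sum_(i < n) tnth a i) (\sum_(i < n) e i))%:E].
Proof.
move=> [a0 suma0]; pose S := pos_support a.
have aS i : i \notin S -> tnth a i = 0%R.
  by rewrite inE -leNgt => ai; apply/eqP; rewrite eq_le ai a0.
pose a' := [tuple tnth a (enum_val j) | j < #|S|].
have a'0 j : (0 < tnth a' j)%R.
  by rewrite tnth_mktuple; have := enum_valP j; rewrite inE.
have suma' : (\sum_(i < n) tnth a i = \sum_(j < #|S|) tnth a' j)%R.
  rewrite (bigID (mem S))/= [X in (_ + X)%R]big1 ?addr0//.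
  by rewrite big_enum_val/=; apply: eq_bigr => j _; rewrite tnth_mktuple.
have S0 : (0 < #|S|)%N.
  rewrite lt0n; apply/eqP => S0; move: suma0; rewrite suma'.
  by rewrite big1 ?ltxx// => j; have := ltn_ord j; rewrite {2}S0.
have [mu' [mu'E mu'S mu'M]] := dirichlet_pos_moments S0 a'0.
have mpad := @measurable_pad_zeros S.
have mS := @measurable_stdsimplex R n.
pose mu0 : {measure set (n.-tuple R) -> \bar R} := pushforward_measure mu' mpad.
have preS : @pad_zeros R n S @^-1` @stdsimplex R n = @stdsimplex R #|S|.
  by apply/seteqP; split => y /stdsimplex_pad_zeros.
have [|mu muE] := @measure_probability _ _ _ mu0.
  by rewrite /mu0/= /pushforward/= preimage_setT probability_setT.
exists mu; split => [A mA||e]; rewrite ?muE.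
- rewrite /mu0/= /pushforward/= mu'E//.
  by rewrite -[X in measurable X]setTI; exact: (mpad measurableT _ mA).
- by rewrite /mu0/= /pushforward/= preS.
transitivity (\int[mu0]_(x in @stdsimplex R n) (monomial e x)%:E).
  by apply: eq_measure_integral => A _ _; exact: muE.
transitivity (\int[mu']_(y in @stdsimplex R #|S|) (monomial e (pad_zeros y))%:E).
  rewrite -preS; apply: (ge0_integral_pushforward mpad _ mS).
  - by apply/measurable_EFinP; exact: measurable_monomial.
  - by move=> x /[!inE] -[x01 _]; rewrite lee_fin monomial_ge0.
(* If [e] vanishes off [S], the factors off [S] are 1 on both sides. Otherwise a null coordinate has
   a positive exponent and both sides are 0. *)
have [eS|/existsNP[i /not_implyP[iS ei]]] := pselect (forall i, i \notin S -> e i = 0%N).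
  have prodE (F : R -> nat -> R) (G : 'I_n -> R) : (forall x, F x 0%N = 1%R) ->
      (\prod_(i < n) F (G i) (e i) =
       \prod_(j < #|S|) F (G (enum_val j)) (e (enum_val j)))%R.
    move=> F1; rewrite (bigID (mem S))/= [X in (_ * X)%R]big1 ?mulr1.
      by rewrite big_enum_val.
    by move=> i iS; rewrite eS.
  transitivity (\int[mu']_(y in @stdsimplex R #|S|)
      (monomial (fun j => e (enum_val j)) y)%:E).
    apply: eq_integral => y _; congr EFin; rewrite /monomial.
    rewrite (prodE (fun x k => x ^+ k)%R (fun i => tnth (pad_zeros y) i))//.
    by apply: eq_bigr => j _; rewrite tnth_pad_zeros_val.
  rewrite mu'M -suma'; congr (_ / rising _ _)%R%:E.
    rewrite (prodE (@rising R) (fun i => tnth a i)); last exact: rising0.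
    by apply: eq_bigr => j _; rewrite tnth_mktuple.
  rewrite [RHS](bigID (mem S))/= [X in (_ + X)%N]big1 ?addn0//.
  by rewrite [RHS]big_enum_val.
have ei0 : e i != 0%N by apply/eqP.
rewrite integral0_eq; last first.
  move=> y _; congr EFin; rewrite /monomial (bigD1 i)//= tnth_pad_zeros0//.
  by rewrite expr0n (negbTE ei0) mul0r.
by rewrite (bigD1 i)//= aS// rising0l (negbTE ei0) !mul0r.
Qed.

End zero_parameters.

(** * Determination by moments *)

Section half_line_approximation.
Context (R : realType).

(* By Bernoulli's inequality, these polynomials converge on [0, 1] to the
   indicator of [0, 1/2[. *)
Definition half_bump (n : nat) (x : R) : R := (1 - x ^+ n) ^+ (n * 2 ^ n).

Lemma half_bump_ge0 n x : 0 <= x <= 1 -> 0 <= half_bump n x.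
Proof.
by move=> /andP[x0 x1]; rewrite exprn_ge0// subr_ge0 exprn_ile1.
Qed.

Lemma half_bump_le1 n x : 0 <= x <= 1 -> half_bump n x <= 1.
Proof.
move=> /andP[x0 x1]; rewrite exprn_ile1 ?subr_ge0 ?exprn_ile1//.
by rewrite lerBlDr lerDl exprn_ge0.
Qed.

Lemma bernoulli_ge (y : R) N : 0 <= y <= 1 -> 1 - N%:R * y <= (1 - y) ^+ N.
Proof.
move=> /andP[y0 y1]; elim: N => [|N IH]; first by rewrite mul0r subr0 expr0.
rewrite exprS (le_trans _ (ler_wpM2l _ IH)) ?subr_ge0//.
have := ler0n R N; rewrite -natr1; nra.
Qed.

(** The induction step is [(1 - y) (1 + (N+1) y) = 1 + N y - (N+1) y^2 <= 1 + N y]. *)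
Lemma bernoulli_le (y : R) N : 0 <= y <= 1 -> (1 - y) ^+ N * (1 + N%:R * y) <= 1.
Proof.
move=> /andP[y0 y1]; elim: N => [|N IH]; first by rewrite mul0r addr0 expr0 mul1r.
apply: le_trans IH; rewrite exprSr -mulrA ler_wpM2l ?exprn_ge0 ?subr_ge0//.
have := ler0n R N; rewrite -natr1; nra.
Qed.

(** With [N = n 2^n] one has [N x^n = n (2x)^n], which tends to 0 for [x < 1/2] and is at least [n]
    for [x >= 1/2]. The factor [n] in [N] settles the point 1/2 itself. *)
Lemma cvg_half_bump x : 0 <= x <= 1 ->
  half_bump n x @[n --> \oo] --> ((x < 2^-1)%R%:R : R).
Proof.
move=> x01; have /andP[x0 x1] := x01.
have xn n : 0 <= x ^+ n <= 1 by rewrite exprn_ge0// exprn_ile1.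
have NE n : (n * 2 ^ n)%N%:R * x ^+ n = n%:R * (2 * x) ^+ n.
  by rewrite natrM natrX exprMn mulrA.
have [xh|xh] := ltP x 2^-1.
  have cvg0 : n%:R * (2 * x) ^+ n @[n --> \oo] --> 0.
    have r0 : 0 <= 2 * x by rewrite mulr_ge0.
    have r1 : 2 * x < 1 by lra.
    have s0 : 0 <= Num.sqrt (2 * x) by rewrite sqrtr_ge0.
    have s1 : Num.sqrt (2 * x) < 1 by rewrite -[ltRHS]sqrtr1 ltr_sqrt.
    (* Bernoulli's inequality for [1 - s] gives [n s^n <= 1 / (1 - s)], hence [n (2x)^n = n s^n s^n]
       is at most [s^n / (1 - s)]. *)
    pose s := Num.sqrt (2 * x).
    apply: (@squeeze_cvgr _ _ _ _ (fun=> 0) (geometric (1 - s)^-1 s)).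
    - apply: nearW => n; rewrite mulr_ge0 ?exprn_ge0//=.
      have sE : 2 * x = s * s by rewrite -expr2 sqr_sqrtr.
      rewrite sE exprMn mulrA ler_wpM2r ?exprn_ge0// -[leRHS]mul1r.
      rewrite ler_pdivlMr ?subr_gt0//.
      have /(bernoulli_le n) : 0 <= 1 - s <= 1 by rewrite /s; lra.
      rewrite opprB addrC subrK; apply: le_trans.
      rewrite -mulrA mulrCA ler_wpM2l ?exprn_ge0//; lra.
    - exact: cvg_cst.
    - by apply: cvg_geometric; rewrite ger0_norm.
  apply: (@squeeze_cvgr _ _ _ _ (fun n => 1 - n%:R * (2 * x) ^+ n) (fun=> 1)).
  - by apply: nearW => n; rewrite half_bump_le1// andbT -NE; exact: bernoulli_ge.
  - by rewrite -[X in _ --> X]subr0; apply: cvgB => //; exact: cvg_cst.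
  - exact: cvg_cst.
apply: (@squeeze_cvgr _ _ _ _ (fun=> 0) (@harmonic R)).
- apply: nearW => n; rewrite half_bump_ge0//=.
  have := bernoulli_le (n * 2 ^ n)%N (xn n); rewrite NE -/(half_bump n x) => h.
  rewrite /harmonic/= -[leRHS]mul1r ler_pdivlMr//.
  apply: le_trans h; rewrite ler_wpM2l ?half_bump_ge0//.
  rewrite -natr1 addrC lerD2l ler_peMr// exprn_ege1//; lra.
- exact: cvg_cst.
- exact: cvg_harmonic.
Qed.

End half_line_approximation.

Section bounded_integrals.
Local Open Scope ereal_scope.
Context d (T : measurableType d) (R : realType).
Variables (mu : {measure set T -> \bar R}) (D : set T).
Hypotheses (mD : measurable D) (muD : mu D < +oo).

Lemma le1_integrable (f : T -> R) : measurable_fun D f ->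
  (forall x, D x -> (0 <= f x <= 1)%R) -> mu.-integrable D (EFin \o f).
Proof.
move=> mf f01; apply: measurable_bounded_integrable => //.
exists 1%R; split => // y y1 x Dx; have /andP[f0 f1] := f01 _ Dx.
by rewrite /= ger0_norm// (le_trans f1)// ltW.
Qed.

Lemma integral_mul_horner (f X : T -> R) (p : {poly R}) :
  measurable_fun D f -> measurable_fun D X ->
  (forall x, D x -> (0 <= f x <= 1)%R) -> (forall x, D x -> (0 <= X x <= 1)%R) ->
  \int[mu]_(x in D) (f x * p.[X x])%:E =
  \sum_(i < size p) (p`_i)%:E * \int[mu]_(x in D) (f x * X x ^+ i)%:E.
Proof.
move=> mf mX f01 X01.
have ifX (i : nat) : mu.-integrable D (fun x => (f x * X x ^+ i)%:E).
  apply: le1_integrable => [|x Dx].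
    by apply: measurable_funM => //; exact: measurable_funX.
  have /andP[f0 f1] := f01 _ Dx; have /andP[X0 X1] := X01 _ Dx.
  by rewrite mulr_ge0 ?exprn_ge0//= mulr_ile1 ?exprn_ge0 ?exprn_ile1.
under eq_integral do rewrite horner_coef mulr_sumr -sumEFin.
rewrite integral_sum//; last first.
  move=> i; apply: (@eq_integrable _ _ _ _ _ mD
    (fun x => (p`_i)%:E * (f x * X x ^+ i)%:E)).
    by move=> x _; rewrite -EFinM mulrCA.
  exact: integrableZl.
apply: eq_bigr => i _; rewrite -integralZl//.
by apply: eq_integral => x _; rewrite -EFinM mulrCA.
Qed.

End bounded_integrals.

Lemma measurable_natr_bool (R : realType) : measurable_fun setT (fun b : bool => b%:R : R).
Proof. by []. Qed.

Section half_line_moments.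
Local Open Scope ereal_scope.
Context d (T : measurableType d) (R : realType).
Variables (m1 m2 : {measure set T -> \bar R}) (D : set T).
Hypotheses (mD : measurable D) (m1D : m1 D < +oo) (m2D : m2 D < +oo).
Variables f X : T -> R.
Hypotheses (mf : measurable_fun D f) (mX : measurable_fun D X).
Hypothesis f01 : forall x, D x -> (0 <= f x <= 1)%R.
Hypothesis X01 : forall x, D x -> (0 <= X x <= 1)%R.

(** The map [x |-> (x - c + 1) / 2] sends [[0, 1]] into itself and [c] to 1/2; the integrands are
    dominated by 1. *)
Let cvg_half_line (mu : {measure set T -> \bar R}) (c : R) : mu D < +oo ->
  (0 <= c <= 1)%R ->
  \int[mu]_(x in D) (f x * half_bump n ((X x - c + 1) / 2))%:E @[n --> \oo] -->
  \int[mu]_(x in D) (f x * (X x < c)%R%:R)%:E.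
Proof.
move=> muD c01.
have y01 x : D x -> (0 <= (X x - c + 1) / 2 <= 1)%R.
  by move=> /X01 x01; rewrite divr_ge0 ?ler_pdivrMr//; lra.
have [] := @dominated_convergence _ T R mu D mD
  (fun n x => (f x * half_bump n ((X x - c + 1) / 2))%:E)
  (fun x => (f x * (X x < c)%R%:R)%:E) (EFin \o cst 1%R) => //.
- move=> n; apply/measurable_EFinP; apply: measurable_funM => //.
  apply: measurable_funX; apply: measurable_funB => //; apply: measurable_funX.
  apply: measurable_funM => //; apply: measurable_funD => //.
  exact: measurable_funB.
- apply/measurable_EFinP; apply: measurable_funM => //.
  apply: (measurableT_comp (@measurable_natr_bool R)).
  exact: measurable_fun_ltr.
- apply/aeW => x Dx; apply: cvg_EFin; first exact: nearW.
  apply: cvgM; first exact: cvg_cst.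
  have -> : (X x < c)%R = ((X x - c + 1) / 2 < 2^-1)%R.
    by apply/idP/idP => h; lra.
  exact: cvg_half_bump (y01 _ Dx).
- by apply: le1_integrable => // x _; rewrite ler01 lexx.
- apply/aeW => x n Dx; have /andP[f0 f1] := f01 Dx.
  have := half_bump_ge0 n (y01 _ Dx); have := half_bump_le1 n (y01 _ Dx).
  move=> h1 h0; rewrite /= lee_fin ger0_norm ?mulr_ge0//.
  by rewrite mulr_ile1.
Qed.

Hypothesis eq_moments : forall k : nat,
  \int[m1]_(x in D) (f x * X x ^+ k)%:E = \int[m2]_(x in D) (f x * X x ^+ k)%:E.

(** The approximants are polynomials in [X], so their integrals against [f] agree. The weight [f]
    will hold the other coordinates, which allows treating one coordinate at a time. *)
Lemma eq_half_line_of_moments (c : R) :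
  \int[m1]_(x in D) (f x * (X x < c)%R%:R)%:E =
  \int[m2]_(x in D) (f x * (X x < c)%R%:R)%:E.
Proof.
have [c0|c0] := ltP c 0%R.
  rewrite !integral0_eq// => x /X01/andP[x0 _];
    by rewrite ltNge (le_trans (ltW c0) x0) mulr0.
have [c1|c1] := ltP 1%R c.
  have E (mu : {measure set T -> \bar R}) : \int[mu]_(x in D) (f x * (X x < c)%R%:R)%:E =
      \int[mu]_(x in D) (f x * X x ^+ 0)%:E.
    apply: eq_integral => x /[!inE] /X01/andP[_ x1].
    by rewrite (le_lt_trans x1 c1) expr0.
  by rewrite !E.
have c01 : (0 <= c <= 1)%R by rewrite c0.
pose p n : {poly R} := ((1 - (2^-1 *: ('X + (1 - c)%:P)) ^+ n) ^+ (n * 2 ^ n)%N)%R.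
have pE n x : half_bump n ((x - c + 1) / 2) = (p n).[x].
  rewrite /p /half_bump !hornerE.
  by congr ((1 - _ ^+ _) ^+ _)%R; rewrite /=; ring.
apply: (cvg_unique _ (cvg_half_line m1D c01)) => //.
rewrite /= (_ : (fun n => _) = fun n =>
    \int[m2]_(x in D) (f x * half_bump n ((X x - c + 1) / 2))%:E).
  exact: cvg_half_line.
apply/funext => n; under eq_integral do rewrite pE.
rewrite integral_mul_horner//; under [RHS]eq_integral do rewrite pE.
by rewrite integral_mul_horner//; apply: eq_bigr => i _; rewrite eq_moments.
Qed.

End half_line_moments.

(** * Measures on the cube and their mixed moments *)

Section moment_determinacy.
Context (R : realType) (n : nat).
Local Open Scope ereal_scope.
Local Notation cube := (@unit_cube R n).

(* A factor of a test function: a power or the indicator of a half-line. *)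
Definition test_factor (s : nat + R) (x : R) : R :=
  match s with inl k => x ^+ k | inr c => (x < c)%R%:R end.

Definition test_fun (s : 'I_n -> nat + R) (x : n.-tuple R) : R :=
  \prod_(i < n) test_factor (s i) (tnth x i).

Lemma test_factor01 s x : (0 <= x <= 1 -> 0 <= test_factor s x <= 1)%R.
Proof.
move=> /andP[x0 x1]; case: s => [k|c] /=; first by rewrite exprn_ge0// exprn_ile1.
by case: (x < c)%R; rewrite /= ?ler01 ?lexx.
Qed.

Lemma measurable_test_factor s : measurable_fun setT (test_factor s).
Proof.
case: s => [k|c] /=; first exact: measurable_funX.
apply: (measurableT_comp (@measurable_natr_bool R)).
exact: measurable_fun_ltr.
Qed.

(** Lower orthants in which [None] leaves a coordinate unconstrained, so that the whole space and
    single half-spaces belong to the family. *)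
Definition halfspaces : set (set (n.-tuple R)) :=
  [set A | exists c : 'I_n -> option R,
    A = [set x | forall i, if c i is Some r then (tnth x i < r)%R else true]].

Lemma halfspaces_setI : setI_closed halfspaces.
Proof.
move=> _ _ [c ->] [c' ->].
exists (fun i => match c i, c' i with
  | Some r, Some r' => Some (Num.min r r') | Some r, None => Some r
  | None, o => o end).
apply/seteqP; split => x /=.
  move=> [h h'] i; have := h i; have := h' i.
  case: (c i) => [r|]; case: (c' i) => [r'|]// rr' rr.
  by rewrite lt_min rr rr'.
move=> h; split => i; have := h i; case: (c i) => [r|]; case: (c' i) => [r'|]//.
  by rewrite lt_min => /andP[].
by rewrite lt_min => /andP[].
Qed.

(** For the nontrivial inclusion it suffices that the coordinates be measurable for the generated
    sigma-algebra: the preimage of []-oo, r[] is an orthant with a single constraint. *)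
Lemma measurable_halfspaces : @measurable _ (n.-tuple R) = <<s halfspaces >>.
Proof.
apply/seteqP; split; last first.
  apply: smallest_sub; first exact: sigma_algebra_measurable.
  move=> _ [c ->]; rewrite (_ : [set x | _] = \bigcap_(i in [set: 'I_n])
    [set x : n.-tuple R | if c i is Some r then (tnth x i < r)%R else true]).
    apply: fin_bigcap_measurable => // i _; case: (c i) => [r|]; last first.
      by rewrite (_ : [set _ | _] = setT)//; apply/seteqP.
    rewrite (_ : [set x | _] = (@tnth n R ^~ i) @^-1` `]-oo, r[%classic).
      rewrite -[X in measurable X]setTI.
      by apply: measurable_tnth => //; exact: measurable_itv.
    by apply/seteqP; split => x /=; rewrite in_itv.
  by apply/seteqP; split => x /= h i; [move=> _; have := h i|have := h i Logic.I];
    rewrite /mkset; case: (c i).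
pose T' := g_sigma_algebraType halfspaces.
have mc i : measurable_fun [set: T'] (fun x : T' => tnth (x : n.-tuple R) i).
  apply: (measurability _ (RGenInftyO.measurableE R)) => _ [_ [r ->] <-].
  apply: sub_sigma_algebra.
  exists (fun j => if j == i then Some r else None).
  rewrite setTI; apply/seteqP; split => x /=.
    by rewrite in_itv/= => xr j; case: eqP => // ->.
  by move=> /(_ i); rewrite eqxx in_itv.
apply: smallest_sub; first exact: smallest_sigma_algebra.
move=> A; rewrite -bigcup_seq => -[i _ [B mB <-]].
exact: (mc i measurableT).
Qed.

Variables m1 m2 : {measure set (n.-tuple R) -> \bar R}.
Hypotheses (m1fin : m1 setT < +oo) (m2fin : m2 setT < +oo).
Hypotheses (m1C : m1 (~` cube) = 0) (m2C : m2 (~` cube) = 0).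
Hypothesis eq_moments : forall e : 'I_n -> nat,
  \int[m1]_(x in cube) (monomial e x)%:E = \int[m2]_(x in cube) (monomial e x)%:E.

Let mcube : measurable cube := @measurable_unit_cube R n.

Let fin_cube (m : {measure set (n.-tuple R) -> \bar R}) : m setT < +oo -> m cube < +oo.
Proof. by apply: le_lt_trans; rewrite le_measure ?inE. Qed.

(** Induction on the number of indicator factors. One of them is traded for arbitrary powers of the
    same coordinate, the remaining factors acting as the weight; without indicators, the test
    function is a monomial. *)
Let eq_test_fun (s : 'I_n -> nat + R) :
  \int[m1]_(x in cube) (test_fun s x)%:E = \int[m2]_(x in cube) (test_fun s x)%:E.
Proof.
pose isr (t : nat + R) := if t is inr _ then true else false.
have [N] := ubnP #|[pred i | isr (s i)]|; elim: N s => // N IH s.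
rewrite ltnS => sN.
have [/existsP[i si]|/existsPn sl] := boolP [exists i, isr (s i)]; last first.
  pose e i := if s i is inl k then k else 0%N.
  have sE x : test_fun s x = monomial e x.
    apply: eq_bigr => i _; have := sl i; rewrite /isr /e.
    by case: (s i).
  by under eq_integral do rewrite sE; under [RHS]eq_integral do rewrite sE.
case sic : (s i) => [k|c]; first by rewrite sic in si.
pose f (x : n.-tuple R) : R := (\prod_(j < n | j != i) test_factor (s j) (tnth x j))%R.
have sE x : test_fun s x = (f x * (tnth x i < c)%R%:R)%R.
  by rewrite /test_fun (bigD1 i)//= sic mulrC.
under eq_integral do rewrite sE; under [RHS]eq_integral do rewrite sE.
apply: eq_half_line_of_moments => //; rewrite ?fin_cube//.
- apply: measurable_funTS; rewrite /f; under eq_fun do rewrite big_mkcond/=.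
  apply: measurable_prod => j _; case: (j != i) => //.
  apply: (measurableT_comp (measurable_test_factor _)); exact: measurable_tnth.
- by apply: measurable_funTS; exact: measurable_tnth.
- move=> x x01; apply/andP; split.
    by apply: prodr_ge0 => j _; have /andP[] := test_factor01 (s j) (x01 j).
  by apply: prodr_ile1 => j _; exact: test_factor01.
move=> k; pose s' j := if j == i then inl k else s j.
have s'E x : (f x * tnth x i ^+ k = test_fun s' x)%R.
  rewrite /test_fun (bigD1 i)//= /s' eqxx mulrC; congr (_ * _)%R.
  by apply: eq_bigr => j /negbTE ->.
under eq_integral do rewrite s'E; under [RHS]eq_integral do rewrite s'E.
apply: IH; apply: leq_trans sN; apply: proper_card; apply/properP; split.
  by apply/fintype.subsetP => j; rewrite !inE /s'; case: (j == i).
by exists i; rewrite !inE ?sic// /s' eqxx.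
Qed.

(** The indicator of an orthant is a test function, an unconstrained coordinate entering with the
    power 0. So the measures agree on a generating family stable under intersection. *)
Lemma moment_determinacy A : measurable A -> m1 A = m2 A.
Proof.
apply: (measure_unique halfspaces (fun=> setT)) => //.
- exact: measurable_halfspaces.
- exact: halfspaces_setI.
- by move=> _; exists (fun=> None); apply/seteqP.
- by apply/seteqP; split => // x _; exists 0%N.
move=> _ [c ->]; set B := [set x | _].
have mB : measurable B.
  rewrite measurable_halfspaces; apply: sub_sigma_algebra.
  by exists c.
pose s i : nat + R := if c i is Some r then inr r else inl 0%N.
have sE x : test_fun s x = \1_B x.
  rewrite indicE /test_fun.
  have [xB|xB] := boolP (x \in B).
    rewrite big1// => i _; have := set_mem xB i; rewrite /s.
    by case: (c i) => [r /= ->|].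
  move: xB; rewrite notin_setE => /existsNP[i ci].
  rewrite (bigD1 i)//= /s; move: ci; case: (c i) => [r|//] /negP/negbTE /= ->.
  by rewrite mul0r.
have E (m : {measure set (n.-tuple R) -> \bar R}) : m (~` cube) = 0 ->
    m B = \int[m]_(x in cube) (test_fun s x)%:E.
  move=> mC; under eq_integral do rewrite sE.
  rewrite integral_indic// -{1}(setIT B) -(setUv cube) setIUr measureU0//.
  - exact: measurableI.
  - by apply: measurableI => //; exact: measurableC.
  - apply: (@subset_measure0 _ _ _ _ _ (~` cube)) => //.
    + by apply: measurableI => //; exact: measurableC.
    + exact: measurableC.
by rewrite (E m1)// (E m2)// eq_test_fun.
Qed.

End moment_determinacy.

(** * The Dirichlet and beta laws solve the size-bias identity *)

Lemma ge0_integral_setX d1 d2 (T1 : measurableType d1) (T2 : measurableType d2)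
    (R : realType) (m1 : {sigma_finite_measure set T1 -> \bar R})
    (m2 : {sigma_finite_measure set T2 -> \bar R}) (D1 : set T1) (D2 : set T2)
    (f : T1 * T2 -> \bar R) :
  measurable D1 -> measurable D2 -> measurable_fun (D1 `*` D2) f ->
  (forall z, (D1 `*` D2) z -> 0 <= f z)%E ->
  (\int[m1 \x m2]_(z in D1 `*` D2) f z =
   \int[m1]_(x in D1) \int[m2]_(y in D2) f (x, y))%E.
Proof.
move=> mD1 mD2 mf f0.
have mD : measurable (D1 `*` D2) by exact: measurableX.
pose g := f \_ (D1 `*` D2).
have mg : measurable_fun setT g by by apply/(measurable_restrictT f).
have g0 z : (0 <= g z)%E by apply: erestrict_ge0.
rewrite [LHS]integral_mkcond.
rewrite [LHS](@fubini_tonelli1 _ _ _ _ _ m1 m2 g mg g0) [RHS]integral_mkcond.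
apply: eq_integral => x _; rewrite patchE /fubini_F.
case: ifPn => xD.
  rewrite [RHS]integral_mkcond; apply: eq_integral => y _.
  by rewrite /g !patchE in_setX xD.
by rewrite integral0_eq// => y _; rewrite /g patchE in_setX (negbTE xD).
Qed.

Section rising_identities.
Context (R : realType).
Implicit Types a : R.

Lemma rising1 k : rising (1 : R) k = k`!%:R.
Proof.
elim: k => [|k IH]; first by rewrite rising0.
by rewrite risingS IH factS natrM mulrC -natr1 addrC.
Qed.

Lemma risingSl a k : rising a k.+1 = a * rising (1 + a) k.
Proof.
rewrite /rising big_ord_recl addr0; congr (_ * _); apply: eq_bigr => i _.
by rewrite (_ : nat_of_ord (lift ord0 i) = i.+1)// -natr1; ring.
Qed.

(** Call the sum [S_k]. Splitting off [l = 0] and using [(k+1)^_(l+1) = (k+1) k^_l] yields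
    [S_(k+1) = rising a (k+1) + (k+1) S_k]. *)
Lemma sum_ffact_rising a k :
  a * \sum_(l < k.+1) (k ^_ l)%:R * rising a (k - l) = rising a k.+1.
Proof.
elim: k => [|k IH].
  by rewrite big_ord1 ffactn0 rising0 risingS rising0 addr0 !mul1r mulr1.
rewrite big_ord_recl ffactn0 subn0 mul1r.
under eq_bigr => l _ do rewrite (_ : nat_of_ord (lift ord0 l) = l.+1)// ffactSS subSS natrM -mulrA.
rewrite -mulr_sumr mulrDr mulrCA IH [in RHS]risingS; ring.
Qed.

End rising_identities.

Section moving.
Context (R : realType) (n : nat).
Implicit Types (i j : 'I_n) (w : R) (x : n.-tuple R) (e : 'I_n -> nat).

(** The exponents left when [l] of the factors at [i] are taken from the summand [w e_i]. *)
Definition shift_exp e i (l : nat) (j : 'I_n) : nat := if j == i then (e i - l)%N else e j.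

Lemma stdsimplex_move i w x : 0 <= w <= 1 -> stdsimplex x ->
  stdsimplex (move_towards i w x).
Proof.
move=> /andP[w0 w1] /stdsimplexP[x0 x1]; apply/stdsimplexP; split.
  by move=> j; rewrite tnth_mktuple addr_ge0 ?mulr_ge0 ?subr_ge0.
under eq_bigr do rewrite tnth_mktuple.
rewrite big_split/= -!mulr_sumr x1 (bigD1 i)//= eqxx big1 => [|j /negbTE ->]//.
by rewrite addr0 !mulr1 subrK.
Qed.

Lemma measurable_move i :
  measurable_fun setT (fun z : n.-tuple R * R => move_towards i z.2 z.1).
Proof.
apply/measurable_fun_tnthP => j.
rewrite (_ : _ \o _ = fun z : n.-tuple R * R =>
    (1 - z.2) * tnth z.1 j + z.2 * (j == i)%:R); last first.
  by apply/funext => z /=; rewrite tnth_mktuple.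
apply: measurable_funD; apply: measurable_funM => //.
  exact: measurable_funB.
by apply: (measurableT_comp (@measurable_tnth _ _ _ j)).
Qed.

(** Only coordinate [i] receives the summand [w], so only its power needs the binomial formula. Each
    factor not taken from [w] contributes a factor [1 - w]. *)
Lemma monomial_move e i w x : monomial e (move_towards i w x) =
  \sum_(l < (e i).+1) 'C(e i, l)%:R *
    (w ^+ l * (1 - w) ^+ (\sum_(j < n) e j - l)) * monomial (shift_exp e i l) x.
Proof.
rewrite /monomial (bigD1 i)//= tnth_mktuple eqxx mulr1 exprDn mulr_suml.
apply: eq_bigr => l _; have le : (l <= e i)%N by rewrite -ltnS.
rewrite [X in _ = _ * (_ * _ ^+ (X - l)) * _](bigD1 i)//=.
rewrite [X in _ = _ * X](bigD1 i)//= {1}/shift_exp eqxx.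
have -> : \prod_(j < n | j != i) tnth (move_towards i w x) j ^+ e j =
    (1 - w) ^+ (\sum_(j < n | j != i) e j) *
    \prod_(j < n | j != i) tnth x j ^+ shift_exp e i l j.
  rewrite expr_sum -big_split/=; apply: eq_bigr => j /negbTE ji.
  by rewrite tnth_mktuple ji mulr0 addr0 exprMn /shift_exp ji.
by rewrite -addnBAC// exprD exprMn -mulr_natl; ring.
Qed.

End moving.

Section mixture_moments.
Context (R : realType) (n : nat).
Local Open Scope ereal_scope.
Local Notation Delta := (@stdsimplex R n).
Local Notation I01 := (`[0%R, 1%R]%classic : set R).
Variables (mu : probability (n.-tuple R) R) (K : probability R R).
Variables (M : ('I_n -> nat) -> R) (k : nat -> nat -> R).
Hypothesis muM : forall e, \int[mu]_(x in Delta) (monomial e x)%:E = (M e)%:E.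
Hypothesis Kk : forall l r, \int[K]_(w in I01) (w ^+ l * (1 - w) ^+ r)%:E = (k l r)%:E.

(** The moments [M] and [k] are kept abstract: they are explicit for the Dirichlet-beta pair and
    unknown in the uniqueness proof. *)
Lemma mixture_moment e i :
  \int[mu]_(x in Delta) \int[K]_(w in I01) (monomial e (move_towards i w x))%:E =
  (\sum_(l < (e i).+1) 'C(e i, l)%:R * k l (\sum_(j < n) e j - l) *
     M (shift_exp e i l))%:E.
Proof.
have mI : measurable I01 by exact: measurable_itv.
have mDelta := @measurable_stdsimplex R n.
have mk l r : measurable_fun I01 (fun w : R => w ^+ l * (1 - w) ^+ r)%R.
  apply: measurable_funTS; apply: measurable_funM; first exact: measurable_funX.
  by apply: measurable_funX; exact: measurable_funB.
have k0 l r w : I01 w -> (0 <= w ^+ l * (1 - w) ^+ r)%R.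
  by rewrite /= in_itv/= => /andP[w0 w1]; rewrite mulr_ge0 ?exprn_ge0// subr_ge0.
transitivity (\int[mu]_(x in Delta) (\sum_(l < (e i).+1)
    ('C(e i, l)%:R * k l (\sum_(j < n) e j - l))%:E * (monomial (shift_exp e i l) x)%:E)).
  apply: eq_integral => x /[!inE] -[x01 _].
  transitivity (\int[K]_(w in I01) (\sum_(l < (e i).+1)
      (('C(e i, l)%:R * monomial (shift_exp e i l) x)%:E *
       (w ^+ l * (1 - w) ^+ (\sum_(j < n) e j - l))%:E))).
    apply: eq_integral => w _; rewrite monomial_move -sumEFin.
    by apply: eq_bigr => l _; rewrite -EFinM mulrAC.
  rewrite ge0_integral_sum//; last 2 first.
  - move=> l; apply: emeasurable_funM => //; apply/measurable_EFinP; exact: mk.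
  - move=> l w Iw; apply: mule_ge0; rewrite lee_fin; last exact: k0.
    by rewrite mulr_ge0 ?monomial_ge0.
  apply: eq_bigr => l _; rewrite ge0_integralZl//; last 3 first.
  - apply/measurable_EFinP; exact: mk.
  - by move=> w Iw; rewrite lee_fin k0.
  - by rewrite lee_fin mulr_ge0 ?monomial_ge0.
  by rewrite Kk -!EFinM mulrAC.
have kk0 l r : (0 <= k l r)%R.
  rewrite -lee_fin -Kk; apply: integral_ge0 => w Iw; rewrite lee_fin; exact: k0.
rewrite ge0_integral_sum//; last 2 first.
- move=> l; apply: emeasurable_funM => //; apply/measurable_EFinP.
  exact: measurable_monomial.
- by move=> l x [x01 _]; rewrite mule_ge0 ?lee_fin ?mulr_ge0 ?monomial_ge0.
rewrite -sumEFin; apply: eq_bigr => l _; rewrite ge0_integralZl//; last 3 first.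
- by apply/measurable_EFinP; exact: measurable_monomial.
- by move=> x [x01 _]; rewrite lee_fin monomial_ge0.
- by rewrite lee_fin mulr_ge0.
by rewrite muM -EFinM.
Qed.

End mixture_moments.

Section dirichlet_size_bias.
Context (R : realType) (n : nat).
Local Open Scope ereal_scope.
Local Notation Delta := (@stdsimplex R n).
Local Notation I01 := (`[0%R, 1%R]%classic : set R).

(** The identity in terms of the laws alone: independence becomes the iterated integral, and the
    enlarged probability space disappears. *)
Definition size_bias_laws (mu : probability (n.-tuple R) R) (K : probability R R)
    (p : 'I_n -> R) : Prop :=
  forall i (g : n.-tuple R -> R), measurable_fun setT g ->
    (forall x, unit_cube x -> (0 <= g x)%R) ->
    \int[mu]_(x in Delta) (g x * tnth x i)%:E =
    (p i)%:E * \int[mu]_(x in Delta) \int[K]_(w in I01) (g (move_towards i w x))%:E.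

(** Each side is the integral of [g] against a finite measure on the cube: [nu1] has density [x_i]
    with respect to [mu], and [nu2] is [p i] times the law of the moved vector. *)
Lemma size_bias_laws_of_moments (mu : probability (n.-tuple R) R)
    (K : probability R R) (p : 'I_n -> R) : (forall i, (0 <= p i)%R) ->
  (forall i e, \int[mu]_(x in Delta) (monomial e x * tnth x i)%:E =
    (p i)%:E * \int[mu]_(x in Delta) \int[K]_(w in I01)
       (monomial e (move_towards i w x))%:E) ->
  size_bias_laws mu K p.
Proof.
move=> p0 mom i.
have mI : measurable I01 by exact: measurable_itv.
have mDelta := @measurable_stdsimplex R n.
have mcube := @measurable_unit_cube R n.
have subD : Delta `<=` @unit_cube R n by move=> x [].
have mti : measurable_fun Delta (fun x => tnth x i).
  by apply: measurable_funTS; exact: measurable_tnth.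
have ti0 x : Delta x -> (0 <= tnth x i)%R by move=> [/(_ i)/andP[]].
pose nu1 : {measure set (n.-tuple R) -> \bar R} := mdensity mu mDelta mti ti0.
pose phi (z : n.-tuple R * R) := move_towards i z.2 z.1.
have mphi : measurable_fun setT phi by exact: measurable_move.
pose E := Delta `*` I01.
have mE : measurable E by exact: measurableX.
(* The constant density 1 on [E] serves to restrict the product measure to [E]. *)
have m1 : measurable_fun E (fun=> 1%R : R) by [].
have p1 z : E z -> (0 <= 1 :> R)%R by [].
pose muK : {measure set (n.-tuple R * R) -> \bar R} := mu \x K.
pose nu2 : {measure set (n.-tuple R) -> \bar R} :=
  mscale (NngNum (p0 i)) (pushforward_measure (mdensity muK mE m1 p1) mphi).
have phiE z : E z -> unit_cube (phi z).
  move=> [zD zI]; apply: subD; apply: stdsimplex_move zD.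
  by move: zI; rewrite /= in_itv.
have nu1E (g : n.-tuple R -> R) : measurable_fun setT g -> (forall x, unit_cube x -> (0 <= g x)%R) ->
    \int[nu1]_(x in @unit_cube R n) (g x)%:E =
    \int[mu]_(x in Delta) (g x * tnth x i)%:E.
  move=> mg g0; rewrite ge0_integral_mdensity//.
  - by rewrite setIidr.
  - by apply/measurable_EFinP; exact: measurable_funTS.
have nu2E (g : n.-tuple R -> R) : measurable_fun setT g -> (forall x, unit_cube x -> (0 <= g x)%R) ->
    \int[nu2]_(x in @unit_cube R n) (g x)%:E = (p i)%:E *
    \int[mu]_(x in Delta) \int[K]_(w in I01) (g (move_towards i w x))%:E.
  move=> mg g0.
  have mg' : measurable_fun (@unit_cube R n) (EFin \o g).
    by apply/measurable_EFinP; exact: measurable_funTS.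
  have mgphi : measurable_fun setT (g \o phi) by exact: measurableT_comp.
  rewrite [LHS]ge0_integral_mscale//; congr (_ * _).
  transitivity (\int[mdensity muK mE m1 p1]_(z in phi @^-1` @unit_cube R n) (g (phi z))%:E).
    apply: (ge0_integral_pushforward mphi) => //.
    by move=> x /[!inE] x01; rewrite lee_fin g0.
  rewrite ge0_integral_mdensity//; last 3 first.
  - by rewrite -[X in measurable X]setTI; exact: (mphi measurableT _ mcube).
  - by apply/measurable_EFinP; exact: measurable_funTS.
  - by move=> z z01; rewrite lee_fin g0.
  rewrite setIidr//; under eq_integral do rewrite mule1.
  rewrite ge0_integral_setX//.
  - by apply/measurable_EFinP; exact: measurable_funTS.
  - by move=> z Ez; rewrite lee_fin g0//; exact: phiE.
have nu12 : forall A, measurable A -> nu1 A = nu2 A.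
  apply: moment_determinacy.
  - rewrite /nu1/= /mdensity setTI; apply: integrable_lty => //.
    apply: le1_integrable => //; last by move=> x [/(_ i)].
    by rewrite (le_lt_trans (probability_le1 mu mDelta))// ltry.
  - rewrite /nu2/= /mscale/= /pushforward/= /mdensity preimage_setT setTI.
    rewrite lte_mul_pinfty ?lee_fin// integral_cst// mul1e.
    by rewrite (le_lt_trans (probability_le1 _ mE))// ltry.
  - rewrite /nu1/= /mdensity (_ : _ `&` _ = set0) ?integral_set0//.
    by apply/seteqP; split => // x [+ /subD].
  - rewrite /nu2/= /mscale/= /pushforward/= /mdensity.
    rewrite (_ : _ `&` _ = set0) ?integral_set0 ?mule0//.
    by apply/seteqP; split => // x [+ /phiE].
  - move=> e; rewrite nu1E; first by rewrite nu2E//;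
      [exact: measurable_monomial|exact: monomial_ge0].
    + exact: measurable_monomial.
    + exact: monomial_ge0.
move=> g mg g0; rewrite -nu1E// -nu2E//.
by apply: eq_measure_integral => A mA _; exact: nu12.
Qed.

Lemma dirichlet_beta_size_bias (a : n.-tuple R) (mu : probability (n.-tuple R) R)
    (K : probability R R) (al := (\sum_(i < n) tnth a i)%R) :
  dirichlet_parameter a ->
  (forall e, \int[mu]_(x in Delta) (monomial e x)%:E =
     ((\prod_(i < n) rising (tnth a i) (e i)) / rising al (\sum_(i < n) e i))%:E) ->
  (forall l r : nat, \int[K]_(w in I01) (w ^+ l * (1 - w) ^+ r)%:E =
     (rising 1 l * rising al r / rising (1 + al) (l + r))%:E) ->
  size_bias_laws mu K (fun i => tnth a i / al)%R.
Proof.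
move=> [a0 al0] muM KM; apply: size_bias_laws_of_moments => [i|i e].
  by rewrite divr_ge0// ltW.
rewrite (mixture_moment muM KM).
(* The size-biasing factor [x_i] is absorbed into the monomial. *)
pose e' j := if j == i then (e i).+1 else e j.
transitivity (\int[mu]_(x in Delta) (monomial e' x)%:E).
  apply: eq_integral => x _; congr EFin.
  rewrite /monomial (bigD1 i)//= [in RHS](bigD1 i)//= /e' eqxx exprSr mulrAC.
  congr (_ * _)%R.
  by apply: eq_bigr => j /negbTE ->.
rewrite muM -EFinM; congr EFin.
set N := (\sum_(j < n) e j)%N.
have eN : (e i <= N)%N by rewrite /N (bigD1 i)//= leq_addr.
have -> : (\sum_(j < n) e' j)%N = N.+1.
  rewrite /N (bigD1 i)//= [in RHS](bigD1 i)//= /e' eqxx addSn; congr (_ + _).+1.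
  by apply: eq_bigr => j /negbTE ->.
pose P := (\prod_(j < n | j != i) rising (tnth a j) (e j))%R.
have -> : (\prod_(j < n) rising (tnth a j) (e' j) = rising (tnth a i) (e i).+1 * P)%R.
  rewrite (bigD1 i)//= /e' eqxx; congr (_ * _)%R.
  by apply: eq_bigr => j /negbTE ->.
rewrite -sum_ffact_rising risingSl.
have r0 k : (0 < rising al k)%R by exact: rising_gt0.
have r1 : (0 < rising (1 + al) N)%R by rewrite rising_gt0// addr_gt0.
transitivity (tnth a i / al * (\sum_(l < (e i).+1)
    (e i ^_ l)%:R * rising (tnth a i) (e i - l) * (P / rising (1 + al) N)))%R.
  by rewrite -mulr_suml; field; rewrite !gt_eqF.
congr (_ * _)%R; apply: eq_bigr => l _.
have le : (l <= e i)%N by rewrite -ltnS.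
have lN : (l <= N)%N by exact: leq_trans eN.
(* The [l!] from the beta moment turns the binomial coefficient into a falling factorial, and
   [rising al (N - l)] cancels against the denominator of the Dirichlet moment. *)
rewrite subnKC// rising1 -bin_ffact natrM.
have -> : (\sum_(j < n) shift_exp e i l j = N - l)%N.
  rewrite (bigD1 i)//= {1}/shift_exp eqxx /N [in RHS](bigD1 i)//= addnBAC//.
  by congr (_ + _ - _)%N; apply: eq_bigr => j /negbTE; rewrite /shift_exp => ->.
have -> : (\prod_(j < n) rising (tnth a j) (shift_exp e i l j) =
    rising (tnth a i) (e i - l) * P)%R.
  rewrite (bigD1 i)//= {1}/shift_exp eqxx; congr (_ * _)%R.
  by apply: eq_bigr => j /negbTE; rewrite /shift_exp => ->.
by field; rewrite !gt_eqF.
Qed.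

End dirichlet_size_bias.

(** * Uniqueness of the solution *)

Section moment_sequences.
Context (R : realType).

(** As [p < q], each step multiplies [m] by a factor no larger than that of [n], so a strict
    inequality persists. It starts at index 2, because [q m_1 = p n_1]. *)
Lemma recursion_strict (p q : R) (c m n : nat -> R) :
  0 < p -> p < q -> p + q = 1 -> c 0 = 1 -> 0 < c 1 -> (forall k, 0 <= c k <= 1) ->
  m 0 = 1 -> n 0 = 1 ->
  (forall k, m k.+1 = m k * (1 - q * c k)) ->
  (forall k, n k.+1 = n k * (1 - p * c k)) ->
  forall k, q * m k.+2 < p * n k.+2.
Proof.
move=> p0 pq pq1 c0 c1 c01 m0 n0 mS nS.
have m_gt0 k : 0 < m k.
  elim: k => [|k IH]; rewrite ?m0// mS mulr_gt0//.
  by have /andP[ck0 ck1] := c01 k; nra.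
elim=> [|k IH].
  (* Here [p n_2 - q m_2 = p q c_1 (q - p)]. *)
  rewrite 2!mS 2!nS m0 n0 c0; have -> : q = 1 - p by lra.
  have : 0 < p * (1 - p) * c 1 * (1 - 2 * p) by rewrite !mulr_gt0//; lra.
  nra.
rewrite mS nS !mulrA.
have /andP[ck0 ck1] := c01 k.+2.
have h1 : 0 < 1 - q * c k.+2 by nra.
have h2 : 1 - q * c k.+2 <= 1 - p * c k.+2 by nra.
apply: (@lt_le_trans _ _ (p * n k.+2 * (1 - q * c k.+2))); first by rewrite ltr_pM2r.
rewrite ler_wpM2l//; apply: le_trans (ltW IH); rewrite mulr_ge0 ?ltW ?m_gt0//; lra.
Qed.

(** Strong induction on [k]; the array [b] stands for the coefficients of the monic polynomials
    [(X - 1)^k]. *)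
Lemma recursion_unique (p q : R) (b : nat -> nat -> R) (c m n c' m' n' : nat -> R) :
  0 < p -> 0 < q -> p != q -> p + q = 1 -> (forall k, b k k = 1) ->
  c 0 = 1 -> c' 0 = 1 -> 0 < c 1 -> c' 1 = c 1 ->
  (forall k, 0 <= c k <= 1) ->
  m 0 = 1 -> n 0 = 1 -> m' 0 = 1 -> n' 0 = 1 ->
  (forall k, m k.+1 = m k * (1 - q * c k)) ->
  (forall k, n k.+1 = n k * (1 - p * c k)) ->
  (forall k, m' k.+1 = m' k * (1 - q * c' k)) ->
  (forall k, n' k.+1 = n' k * (1 - p * c' k)) ->
  (forall k, n k = (-1) ^+ k * \sum_(j < k.+1) b k j * m j) ->
  (forall k, n' k = (-1) ^+ k * \sum_(j < k.+1) b k j * m' j) ->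
  forall k, c k = c' k.
Proof.
move=> p0 q0 pq pq1 bk c0 c0' c1 c1' c01 m0 n0 m0' n0' mS nS mS' nS' nE nE' k.
have [N] := ubnP k; elim: N k => // N IH k; rewrite ltnS => kN.
have cE j : (j < k)%N -> c j = c' j by move=> jk; apply: IH; exact: leq_trans kN.
have mE j : (j <= k)%N -> m j = m' j.
  elim: j => [|j IHj] jk; first by rewrite m0 m0'.
  by rewrite mS mS' IHj ?cE// ltnW.
have nnE j : (j <= k)%N -> n j = n' j.
  elim: j => [|j IHj] jk; first by rewrite n0 n0'.
  by rewrite nS nS' IHj ?cE// ltnW.
case: k => [|[|k]] in cE mE nnE kN *; [by rewrite c0 c0'|by rewrite c1'|].
have m_gt0 j : 0 < m j.
  elim: j => [|j IHj]; rewrite ?m0// mS mulr_gt0//.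
  by have /andP[cj0 cj1] := c01 j; nra.
have n_gt0 j : 0 < n j.
  elim: j => [|j IHj]; rewrite ?n0// nS mulr_gt0//.
  by have /andP[cj0 cj1] := c01 j; nra.
(* In the odd case with [q < p], the strict inequality is applied with [(p, m)] and [(q, n)]
   exchanged. *)
have ne : p * n k.+2 + (-1) ^+ k.+2 * (q * m k.+2) != 0.
  rewrite -signr_odd; case: (odd _); last first.
    by rewrite mul1r gt_eqF// addr_gt0// mulr_gt0.
  rewrite mulN1r subr_eq0; move: pq; rewrite neq_lt => /orP[pq|qp].
    by rewrite gt_eqF//; exact: (recursion_strict p0 pq pq1 c0 c1 c01).
  rewrite lt_eqF//; apply: (recursion_strict q0 qp _ c0 c1 c01) => //.
  by rewrite addrC.
(* The lower moments agree by induction, so the difference of the two expansions retains only its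
   top term, of coefficient 1. *)
have E : n k.+3 - n' k.+3 = (-1) ^+ k.+3 * (m k.+3 - m' k.+3).
  rewrite nE nE' -mulrBr; congr (_ * _).
  rewrite big_ord_recr [X in _ - X]big_ord_recr/= !bk !mul1r.
  rewrite (eq_bigr (fun j : 'I_k.+3 => b k.+3 j * m' j)); first by ring.
  by move=> j _; rewrite mE// -ltnS.
(* By the recursions, [E] says that the quantity in [ne] times [c k.+2 - c' k.+2] is 0. *)
move: E; rewrite mS nS mS' nS' -(mE _ (leqnn _)) -(nnE _ (leqnn _)) => E.
apply/eqP; rewrite -subr_eq0; apply/eqP; apply: (mulfI ne); rewrite mulr0.
move: E; rewrite exprS => E; nra.
Qed.

End moment_sequences.

(** * Recursions for the moments of a block of coordinates *)

Section uniqueness.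
Context (R : realType) (n : nat).
Local Open Scope ereal_scope.
Local Notation Delta := (@stdsimplex R n).
Local Notation I01 := (`[0%R, 1%R]%classic : set R).
Implicit Types (mu : probability (n.-tuple R) R) (K : probability R R).
Implicit Types (B : {set 'I_n}) (x : n.-tuple R) (w : R).

Definition block (B : {set 'I_n}) (x : n.-tuple R) : R := (\sum_(i in B) tnth x i)%R.

Lemma measurable_block B : measurable_fun setT (block B).
Proof.
rewrite /block; under eq_fun do rewrite big_mkcond/=.
apply: measurable_sum => i; case: (i \in B) => //; exact: measurable_tnth.
Qed.

Lemma block_setC B x : Delta x -> block (~: B) x = (1 - block B x)%R.
Proof.
move=> /stdsimplexP[_ <-]; rewrite /block [in RHS](bigID (mem B))/= addrAC subrr add0r.
by apply: eq_bigl => i; rewrite inE.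
Qed.

Lemma block_ge0 B x : unit_cube x -> (0 <= block B x)%R.
Proof. by move=> x01; apply: sumr_ge0 => i _; have /andP[] := x01 i. Qed.

Lemma block01 B x : Delta x -> (0 <= block B x <= 1)%R.
Proof.
move=> Dx; have [x01 _] := Dx; rewrite block_ge0//= -subr_ge0 -block_setC//.
exact: block_ge0.
Qed.

Lemma block_move B i w x : i \notin B ->
  block B (move_towards i w x) = ((1 - w) * block B x)%R.
Proof.
move=> iB; rewrite /block mulr_sumr; apply: eq_bigr => j jB.
rewrite tnth_mktuple (_ : (j == i) = false) ?mulr0 ?addr0//.
by apply: contraNF iB => /eqP <-.
Qed.

(** In the notation of the overview this is [m_k], its value at [~: B] is [n_k], and
    [remainder_moment] is [c_k]. *)
Definition block_moment mu B (k : nat) : R :=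
  fine (\int[mu]_(x in Delta) (block B x ^+ k)%:E).

Definition remainder_moment K (k : nat) : R :=
  fine (\int[K]_(w in I01) ((1 - w) ^+ k)%:E).

Let mDelta := @measurable_stdsimplex R n.
Let mI : measurable I01. Proof. exact: measurable_itv. Qed.

Lemma probability_lty d (T : measurableType d) (P : probability T R) A :
  measurable A -> P A < +oo.
Proof. by move=> mA; rewrite (le_lt_trans (probability_le1 _ mA))// ltry. Qed.

Lemma integral01_fineK d (T : measurableType d) (P : probability T R) D (f : T -> R) :
  measurable D -> measurable_fun D f -> (forall t, D t -> (0 <= f t <= 1)%R) ->
  (fine (\int[P]_(x in D) (f x)%:E))%:E = \int[P]_(x in D) (f x)%:E.
Proof.
move=> mD mf f01; rewrite fineK//; apply: integrable_fin_num => //.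
by apply: le1_integrable => //; exact: probability_lty.
Qed.

Lemma EFin_block_moment mu B k :
  (block_moment mu B k)%:E = \int[mu]_(x in Delta) (block B x ^+ k)%:E.
Proof.
apply: integral01_fineK => //.
  by apply: measurable_funTS; apply: measurable_funX; exact: measurable_block.
by move=> x /(block01 B)/andP[x0 x1]; rewrite exprn_ge0// exprn_ile1.
Qed.

Lemma remainder01 k w : I01 w -> (0 <= (1 - w) ^+ k <= 1)%R.
Proof.
rewrite /= in_itv/= => /andP[w0 w1].
by rewrite exprn_ge0 ?subr_ge0// exprn_ile1 ?subr_ge0// lerBlDr lerDl.
Qed.

Lemma measurable_remainder k D : measurable_fun D (fun w : R => (1 - w) ^+ k)%R.
Proof. by apply: measurable_funTS; apply: measurable_funX; exact: measurable_funB. Qed.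

Lemma EFin_remainder_moment K k :
  (remainder_moment K k)%:E = \int[K]_(w in I01) ((1 - w) ^+ k)%:E.
Proof.
apply: integral01_fineK => //; first exact: measurable_remainder.
exact: remainder01.
Qed.

Lemma block_moment0 mu B : mu Delta = 1 -> block_moment mu B 0 = 1%R.
Proof.
move=> muD; rewrite /block_moment; under eq_integral do rewrite expr0.
by rewrite integral_cst// mul1e; exact: (congr1 fine muD).
Qed.

Lemma remainder_moment01 K k : (0 <= remainder_moment K k <= 1)%R.
Proof.
rewrite -!lee_fin EFin_remainder_moment; apply/andP; split.
  by apply: integral_ge0 => w /(remainder01 k)/andP[]; rewrite lee_fin.
apply: (@le_trans _ _ (\int[K]_(w in I01) 1)).
  apply: ge0_le_integral => //.
  - by move=> w /(remainder01 k)/andP[]; rewrite lee_fin.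
  - by apply/measurable_EFinP; exact: measurable_remainder.
  - by move=> w /(remainder01 k)/andP[_]; rewrite lee_fin.
by rewrite integral_cst// mul1e probability_le1.
Qed.

Lemma block_recursion mu K p B k : size_bias_laws mu K p ->
  block_moment mu B k.+1 = (block_moment mu B k *
    (1 - (\sum_(i in ~: B) p i) * remainder_moment K k))%R.
Proof.
move=> sb.
have mB j : measurable_fun setT (fun x => block B x ^+ j)%R.
  by apply: measurable_funX; exact: measurable_block.
have B0 j x : unit_cube x -> (0 <= block B x ^+ j)%R.
  by move=> x01; rewrite exprn_ge0 ?block_ge0.
have step i : i \in ~: B -> \int[mu]_(x in Delta) (block B x ^+ k * tnth x i)%:E =
    (p i * (remainder_moment K k * block_moment mu B k))%:E.
  rewrite inE => iB; rewrite (sb i (fun x => block B x ^+ k)%R (mB k) (B0 k)) 2!EFinM EFin_block_moment; congr (_ * _).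
  rewrite -ge0_integralZl//; last 3 first.
  - by apply/measurable_EFinP; exact: measurable_funTS.
  - by move=> x [x01 _]; rewrite lee_fin B0.
  - by rewrite lee_fin; have /andP[] := remainder_moment01 K k.
  apply: eq_integral => x /[!inE] -[x01 _].
  under eq_integral do rewrite block_move// exprMn EFinM.
  rewrite ge0_integralZr//; last 3 first.
  - by apply/measurable_EFinP; exact: measurable_remainder.
  - by move=> w /(remainder01 k)/andP[]; rewrite lee_fin.
  - by rewrite lee_fin B0.
  by rewrite EFin_remainder_moment.
have split_sum : block_moment mu B k = (block_moment mu B k.+1 +
    \sum_(i in ~: B) p i * (remainder_moment K k * block_moment mu B k))%R.
  apply: EFin_inj; rewrite EFinD -sumEFin !EFin_block_moment.
  rewrite [X in _ + X](eq_bigr _ (fun i iB => esym (step i iB))).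
  have iB (j : nat) i : mu.-integrable Delta (fun x => (block B x ^+ j * tnth x i)%:E).
    apply: le1_integrable => //; first exact: probability_lty.
      by apply: measurable_funTS; apply: measurable_funM => //; exact: measurable_tnth.
    move=> x Dx; have [/(_ i)/andP[xi0 xi1] _] := Dx.
    have /andP[X0 X1] := block01 B Dx.
    by rewrite mulr_ge0 ?exprn_ge0//= mulr_ile1 ?exprn_ge0 ?exprn_ile1.
  have iB1 : mu.-integrable Delta (fun x => (block B x ^+ k.+1)%:E).
    apply: le1_integrable => //; first exact: probability_lty.
      exact: measurable_funTS.
    by move=> x Dx; have /andP[X0 X1] := block01 B Dx; rewrite exprn_ge0// exprn_ile1.
  rewrite -integral_sum// -integralD//; last by apply: integrable_sum => // i _; exact: iB.
  apply: eq_integral => x /[!inE] Dx; rewrite sumEFin -EFinD -mulr_sumr.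
  by rewrite -/(block (~: B) x) block_setC// exprSr; congr EFin; ring.
rewrite -[in RHS]mulr_suml in split_sum.
by rewrite mulrBr mulr1 [X in (X - _)%R]split_sum; ring.
Qed.

End uniqueness.

(** * Uniqueness of both laws *)

Section laws_unique.
Context (R : realType) (n : nat).
Local Open Scope ereal_scope.
Local Notation Delta := (@stdsimplex R n).
Local Notation I01 := (`[0%R, 1%R]%classic : set R).

Let mDelta := @measurable_stdsimplex R n.
Let mI : measurable I01. Proof. exact: measurable_itv. Qed.

(** This expands [(1 - X)^k = (-1)^k (X - 1)^k]; with the sign outside, the polynomial is monic. *)
Lemma block_moment_setC (mu : probability (n.-tuple R) R) (B : {set 'I_n}) k :
  block_moment mu (~: B) k =
  ((-1) ^+ k * \sum_(j < k.+1) (('X - 1%:P) ^+ k : {poly R})`_j * block_moment mu B j)%R.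
Proof.
pose p : {poly R} := ((-1) ^+ k *: ('X - 1%:P) ^+ k)%R.
have sp : size p = k.+1.
  by rewrite size_scale ?signr_eq0// size_exp_XsubC.
apply: EFin_inj; rewrite EFin_block_moment.
transitivity (\int[mu]_(x in Delta) (1 * p.[block B x])%:E).
  apply: eq_integral => x /[!inE] Dx.
  rewrite block_setC// mul1r /p hornerZ horner_exp !hornerE -exprMn.
  by congr (_ ^+ _)%:E; ring.
rewrite integral_mul_horner//.
- rewrite sp mulr_sumr -sumEFin; apply: eq_bigr => j _.
  rewrite /p coefZ mulrA [RHS]EFinM EFin_block_moment; congr (_ * _).
  by apply: eq_integral => x _; rewrite mul1r.
- exact: probability_lty.
- by apply: measurable_funTS; exact: measurable_block.
- by move=> x _; rewrite ler01 lexx.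
- by move=> x Dx; exact: block01.
Qed.

Section remainder.
Variables (mu mu' : probability (n.-tuple R) R) (K K' : probability R R).
Variables (p : 'I_n -> R) (B : {set 'I_n}).
Hypotheses (sb : size_bias_laws mu K p) (sb' : size_bias_laws mu' K' p).
Hypotheses (muD : mu Delta = 1) (mu'D : mu' Delta = 1).
Hypotheses (KI : K I01 = 1) (K'I : K' I01 = 1).
Hypotheses (p1 : (\sum_(i < n) p i = 1)%R).
Hypotheses (pB : (0 < \sum_(i in B) p i < 1)%R).
Hypotheses (pB2 : (\sum_(i in B) p i != 1 / 2)%R).
Hypotheses (c0 : (0 < remainder_moment K 1)%R).
Hypothesis (cc' : remainder_moment K' 1 = remainder_moment K 1).

Let remainder_moment0 (L : probability R R) : L I01 = 1 -> remainder_moment L 0 = 1%R.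
Proof.
move=> LI; rewrite /remainder_moment; under eq_integral do rewrite expr0.
by rewrite integral_cst// mul1e; exact: (congr1 fine LI).
Qed.

Lemma remainder_moment_unique k : remainder_moment K k = remainder_moment K' k.
Proof.
have /andP[pB0 pB1] := pB.
have sumC : (\sum_(i in ~: B) p i = 1 - \sum_(i in B) p i)%R.
  rewrite -p1 [in RHS](bigID (mem B))/= addrAC subrr add0r.
  by apply: eq_bigl => i; rewrite inE.
apply: (@recursion_unique R (\sum_(i in B) p i) (\sum_(i in ~: B) p i)
  (fun k j => (('X - 1%:P) ^+ k : {poly R})`_j)%R
  (remainder_moment K) (block_moment mu B) (block_moment mu (~: B))
  (remainder_moment K') (block_moment mu' B) (block_moment mu' (~: B))) => //.
- by rewrite sumC subr_gt0.
- by rewrite sumC; apply: contra pB2 => /eqP h; apply/eqP; lra.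
- by rewrite sumC addrC subrK.
- move=> j; have /monicP := monic_exp j (monicXsubC (1 : R)%R).
  by rewrite lead_coefE size_exp_XsubC.
- exact: remainder_moment0.
- exact: remainder_moment0.
- exact: remainder_moment01.
- exact: block_moment0.
- exact: block_moment0.
- exact: block_moment0.
- exact: block_moment0.
- by move=> j; exact: block_recursion.
- by move=> j; rewrite (block_recursion _ _ sb) finset.setCK.
- by move=> j; exact: block_recursion.
- by move=> j; rewrite (block_recursion _ _ sb') finset.setCK.
- exact: block_moment_setC.
- exact: block_moment_setC.
Qed.

(** Under [w |-> 1 - w], the numbers [c_k] become ordinary moments of a law on [[0, 1]], viewed as
    the cube of dimension 1. *)
Lemma size_bias_laws_unique_remainder A : measurable A -> K A = K' A.
Proof.
move=> mA.
pose f (w : R) : 1.-tuple R := [tuple (1 - w)%R].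
have mf : measurable_fun setT f.
  apply/measurable_fun_tnthP => i.
  rewrite (_ : _ \o _ = fun w : R => (1 - w)%R); first exact: measurable_funB.
  by apply/funext => w /=; rewrite ord1 tnth0.
pose g (x : 1.-tuple R) : R := (1 - tnth x ord0)%R.
have mg : measurable_fun setT g by apply: measurable_funB => //; exact: measurable_tnth.
have gf w : g (f w) = w by rewrite /g /f tnth0; ring.
have fI : I01 = f @^-1` @unit_cube R 1.
  apply/seteqP; split => w /=; rewrite in_itv/=.
    by move=> /andP[w0 w1] i; rewrite ord1 tnth0; lra.
  by move=> /(_ ord0); rewrite tnth0; lra.
have mcube := @measurable_unit_cube R 1.
have mom (L : probability R R) e : \int[pushforward_measure L mf]_(x in @unit_cube R 1)
    (monomial e x)%:E = (remainder_moment L (e ord0))%:E.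
  rewrite EFin_remainder_moment.
  transitivity (\int[L]_(w in f @^-1` @unit_cube R 1) (monomial e (f w))%:E).
    apply: (ge0_integral_pushforward mf _ mcube).
    - by apply/measurable_EFinP; exact: measurable_monomial.
    - by move=> x /[!inE] x01; rewrite lee_fin monomial_ge0.
  by rewrite -fI; apply: eq_integral => w _; rewrite /monomial big_ord1 tnth0.
have := @moment_determinacy R 1 (pushforward_measure K mf) (pushforward_measure K' mf).
have fT (L : probability R R) : pushforward_measure L mf setT < +oo.
  by rewrite /= /pushforward preimage_setT probability_lty.
have fC (L : probability R R) : L I01 = 1 -> pushforward_measure L mf (~` @unit_cube R 1) = 0.
  move=> LI; rewrite /= /pushforward -preimage_setC -fI probability_setC// LI.
  by rewrite subee.
move=> /(_ (fT K) (fT K') (fC K KI) (fC K' K'I)).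
have mgA : measurable (g @^-1` A) by rewrite -[X in measurable X]setTI; exact: mg.
move=> /(_ _ _ mgA); rewrite /= /pushforward.
rewrite (_ : f @^-1` (g @^-1` A) = A); last by apply/seteqP; split => w /=; rewrite gf.
by apply => e; rewrite !mom remainder_moment_unique.
Qed.

Lemma monomial_moment_unique e :
  \int[mu]_(x in Delta) (monomial e x)%:E = \int[mu']_(x in Delta) (monomial e x)%:E.
Proof.
have mono01 e' x : Delta x -> (0 <= monomial e' x <= 1)%R.
  move=> [x01 _]; rewrite monomial_ge0//=.
  apply: prodr_ile1 => i _; have /andP[xi0 xi1] := x01 i.
  by rewrite exprn_ge0// exprn_ile1.
pose M (nu : probability (n.-tuple R) R) e := fine (\int[nu]_(x in Delta) (monomial e x)%:E).
pose kk (L : probability R R) l r := fine (\int[L]_(w in I01) (w ^+ l * (1 - w) ^+ r)%:E).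
have ME (nu : probability (n.-tuple R) R) e' :
    \int[nu]_(x in Delta) (monomial e' x)%:E = (M nu e')%:E.
  apply/esym/integral01_fineK => //; first exact: measurable_monomial.
  exact: mono01.
have kE (L : probability R R) l r :
    \int[L]_(w in I01) (w ^+ l * (1 - w) ^+ r)%:E = (kk L l r)%:E.
  apply/esym/integral01_fineK => //.
    by apply: measurable_funM; [exact: measurable_funX|exact: measurable_remainder].
  move=> w Iw; have /andP[r0 r1] := remainder01 r Iw.
  move: Iw; rewrite /= in_itv/= => /andP[w0 w1].
  by rewrite mulr_ge0 ?(exprn_ge0 _ w0)//= mulr_ile1 ?(exprn_ge0 _ w0)// exprn_ile1.
have kkE l r : kk K l r = kk K' l r.
  congr fine; apply: eq_measure_integral => A mA _.
  exact: size_bias_laws_unique_remainder.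
have [N] := ubnP (\sum_(i < n) e i)%N; elim: N e => // N IH e; rewrite ltnS => eN.
have [e0|/existsNP[i /eqP ei]] := pselect (forall i, e i = 0%N).
  have E1 (nu : probability (n.-tuple R) R) :
      \int[nu]_(x in Delta) (monomial e x)%:E = nu Delta.
    rewrite -[RHS]mul1e -integral_cst//; apply: eq_integral => x _.
    by rewrite /monomial big1// => i _; rewrite e0 expr0.
  by rewrite !E1 muD.
(* One factor [x_i] is split off the monomial and plays the role of the size bias. *)
pose e1 j := if j == i then (e i).-1 else e j.
have e1N : ((\sum_(j < n) e1 j).+1 = \sum_(j < n) e j)%N.
  rewrite (bigD1 i)//= [in RHS](bigD1 i)//= /e1 eqxx -addSn prednK ?lt0n//.
  by congr (_ + _)%N; apply: eq_bigr => j /negbTE ->.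
have E2 (nu : probability (n.-tuple R) R) : \int[nu]_(x in Delta) (monomial e x)%:E =
    \int[nu]_(x in Delta) (monomial e1 x * tnth x i)%:E.
  apply: eq_integral => x _; congr EFin.
  rewrite /monomial (bigD1 i)//= [in RHS](bigD1 i)//= /e1 eqxx mulrAC -exprSr.
  rewrite prednK ?lt0n//; congr (_ * _)%R.
  by apply: eq_bigr => j /negbTE ->.
have m1 := @measurable_monomial R n e1 setT.
rewrite !E2 (sb i m1 (@monomial_ge0 R n e1)) (sb' i m1 (@monomial_ge0 R n e1)).
rewrite (mixture_moment (ME mu) (kE K)) (mixture_moment (ME mu') (kE K')).
congr (_ * _%:E); apply: eq_bigr => l _; rewrite kkE; congr (_ * _)%R.
(* The mixture side involves monomials of degree at most that of [e1], one less than the degree of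
   [e]. *)
congr fine; apply: IH; apply: leq_trans eN; rewrite -e1N ltnS.
apply: leq_sum => j _; rewrite /shift_exp; case: eqP => // ->; exact: leq_subr.
Qed.

Lemma size_bias_laws_unique A : measurable A -> mu A = mu' A.
Proof.
have subD : Delta `<=` @unit_cube R n by move=> x [].
have mcube := @measurable_unit_cube R n.
have nuC (nu : probability (n.-tuple R) R) : nu Delta = 1 -> nu (~` Delta) = 0.
  by move=> nuD; rewrite probability_setC// nuD subee.
have cubeE (nu : probability (n.-tuple R) R) e : nu Delta = 1 ->
    \int[nu]_(x in @unit_cube R n) (monomial e x)%:E =
    \int[nu]_(x in Delta) (monomial e x)%:E.
  move=> nuD; rewrite (@ge0_negligible_integral _ _ _ nu _ (~` Delta))//.
  - by rewrite setDE setCK setIidr.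
  - exact: measurableC.
  - by apply/measurable_EFinP; exact: measurable_monomial.
  - by move=> x x01; rewrite lee_fin monomial_ge0.
  - exact: nuC.
have cubeC (nu : probability (n.-tuple R) R) : nu Delta = 1 -> nu (~` @unit_cube R n) = 0.
  move=> nuD; apply: (@subset_measure0 _ _ _ nu _ (~` Delta)).
  - exact: measurableC.
  - exact: measurableC.
  - exact: subsetC.
  - exact: nuC.
apply: moment_determinacy.
- exact: probability_lty.
- exact: probability_lty.
- exact: cubeC.
- exact: cubeC.
- by move=> e; rewrite !cubeE// monomial_moment_unique.
Qed.

End remainder.

End laws_unique.

(** * Random variables and their laws *)

Section mixtures.
Context (R : realType) (n : nat) (d : measure_display) (T : measurableType d).
Variables (P : probability T R) (Z : {RV P >-> n.-tuple R}).
Hypothesis Z_simplex : forall t, stdsimplex (Z t).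
Local Open Scope ereal_scope.
Local Notation Delta := (@stdsimplex R n).
Local Notation I01 := (`[0%R, 1%R]%classic : set R).
Local Notation muZ := (distribution P Z : probability (n.-tuple R) R).

Let mDelta := @measurable_stdsimplex R n.
Let mI : measurable I01. Proof. exact: measurable_itv. Qed.
Let mZ : measurable_fun setT Z := measurable_funPT Z.

Let Z_preimage : Z @^-1` Delta = setT.
Proof. by apply/seteqP; split => // t _; exact: Z_simplex. Qed.

Lemma distribution_simplex : muZ Delta = 1.
Proof. by rewrite /= /distribution /pushforward Z_preimage probability_setT. Qed.

Lemma integral_distribution_simplex (f : n.-tuple R -> R) : measurable_fun setT f ->
  (forall x, Delta x -> (0 <= f x)%R) ->
  \int[P]_t (f (Z t))%:E = \int[muZ]_(x in Delta) (f x)%:E.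
Proof.
move=> mf f0; rewrite -Z_preimage; apply/esym/(ge0_integral_pushforward mZ _ mDelta).
- by apply/measurable_EFinP; exact: measurable_funTS.
- by move=> x /[!inE] /f0; rewrite lee_fin.
Qed.

Lemma mean_vectorE i :
  (tnth (mean_vector P Z) i)%:E = \int[muZ]_(x in Delta) (tnth x i)%:E.
Proof.
rewrite tnth_mktuple unlock (@integral_distribution_simplex (fun x => tnth x i))//; last 2 first.
- exact: measurable_tnth.
- by move=> x [/(_ i)/andP[]].
apply: integral01_fineK => //; last by move=> x [/(_ i)].
by apply: measurable_funTS; exact: measurable_tnth.
Qed.

Lemma mean_vector_simplex : (forall i, 0 <= tnth (mean_vector P Z) i)%R /\
  (\sum_(i < n) tnth (mean_vector P Z) i = 1)%R.
Proof.
split=> [i|].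
  rewrite -lee_fin mean_vectorE; apply: integral_ge0 => x [/(_ i)/andP[x0 _] _].
  by rewrite lee_fin.
apply: EFin_inj; rewrite -sumEFin; under eq_bigr do rewrite mean_vectorE.
rewrite -integral_sum//; last first.
  move=> i; apply: le1_integrable => //; last by move=> x [/(_ i)].
    exact: probability_lty.
  by apply: measurable_funTS; exact: measurable_tnth.
transitivity (\int[muZ]_(x in Delta) 1).
  by apply: eq_integral => x /[!inE] -[_ x1]; rewrite sumEFin x1.
by rewrite integral_cst// mul1e; exact: distribution_simplex.
Qed.

Section expectations.
Context (d' : measure_display) (T' : measurableType d') (Q : probability T' R).
Variables (proj : {RV Q >-> T}) (W : {RV Q >-> R}).
Hypothesis proj_law : has_law proj P.
Hypothesis W01 : forall t, (0 <= W t <= 1)%R.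
Hypothesis ZW : independent Q (Z \o proj) W.
Local Notation KW := (distribution Q W : probability R R).

Let mproj : measurable_fun setT proj := measurable_funPT proj.
Let mW : measurable_fun setT W := measurable_funPT W.

Let W_preimage : W @^-1` I01 = setT.
Proof. by apply/seteqP; split => // t _; rewrite /= in_itv/=; exact: W01. Qed.

Lemma distribution_unit_interval : KW I01 = 1.
Proof. by rewrite /= /distribution /pushforward W_preimage probability_setT. Qed.

Lemma expectation_remainder : 'E_Q[W] = (1 - remainder_moment KW 1)%R%:E.
Proof.
have iW (f : R -> R) : measurable_fun setT f ->
    (forall w, I01 w -> (0 <= f w <= 1)%R) -> KW.-integrable I01 (EFin \o f).
  move=> mf f01; apply: le1_integrable => //; first exact: probability_lty.
  exact: measurable_funTS.
transitivity (\int[KW]_(w in I01) w%:E).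
  rewrite unlock -W_preimage; apply/esym/(ge0_integral_pushforward mW _ mI) => //.
  by move=> w /[!inE]/=; rewrite in_itv/= lee_fin => /andP[].
transitivity (\int[KW]_(w in I01) (1 - ((1 - w) ^+ 1)%:E)).
  by apply: eq_integral => w _; rewrite -EFinB expr1 subKr.
rewrite integralB//; last 2 first.
- by apply: (iW (cst 1%R)) => // w _; rewrite ler01 lexx.
- by apply: iW; [exact: measurable_remainder|move=> w; exact: remainder01].
rewrite -EFin_remainder_moment integral_cst// mul1e EFinB; congr (_ - _).
exact: distribution_unit_interval.
Qed.

Lemma expectation_size_bias i (g : n.-tuple R -> R) : measurable_fun setT g ->
  (forall x, unit_cube x -> (0 <= g x)%R) ->
  'E_Q[fun t => (g (Z (proj t)) * tnth (Z (proj t)) i)%R] =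
  \int[muZ]_(x in Delta) (g x * tnth x i)%:E.
Proof.
move=> mg g0; pose f x := (g x * tnth x i)%R.
have mf : measurable_fun setT f.
  by apply: measurable_funM => //; exact: measurable_tnth.
have f0 x : Delta x -> (0 <= f x)%R.
  by move=> -[x01 _]; have /andP[xi0 _] := x01 i; rewrite mulr_ge0// g0.
rewrite unlock -integral_distribution_simplex//.
transitivity (\int[pushforward_measure Q mproj]_t (f (Z t))%:E).
  apply/esym; rewrite -(preimage_setT proj).
  apply: (ge0_integral_pushforward mproj) => //.
  - by apply/measurable_EFinP; exact: measurableT_comp.
  - by move=> t _; rewrite lee_fin f0.
by apply: eq_measure_integral => A mA _; exact: proj_law.
Qed.

Lemma expectation_mixture i (g : n.-tuple R -> R) : measurable_fun setT g ->
  (forall x, unit_cube x -> (0 <= g x)%R) ->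
  'E_Q[fun t => g (move_towards i (W t) (Z (proj t)))] =
  \int[muZ]_(x in Delta) \int[KW]_(w in I01) (g (move_towards i w x))%:E.
Proof.
move=> mg g0; pose phi t := (Z (proj t), W t).
have mphi : measurable_fun setT phi.
  by apply: measurable_fun_pair => //; exact: measurableT_comp.
pose h (z : n.-tuple R * R) := (g (move_towards i z.2 z.1))%:E.
have mh D : measurable_fun D h.
  apply: measurable_funTS; apply/measurable_EFinP; apply: (measurableT_comp mg).
  exact: measurable_move.
have h0 z : (Delta `*` I01) z -> 0 <= h z.
  move=> [zD]; rewrite /= in_itv/= => zI; rewrite lee_fin g0//.
  by have [] := stdsimplex_move i zI zD.
rewrite -(@ge0_integral_setX _ _ _ _ _ muZ KW _ _ h)// unlock.
have mDI : measurable (Delta `*` I01) by exact: measurableX.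
transitivity (\int[pushforward_measure Q mphi]_(z in Delta `*` I01) h z).
  have -> : [set: T'] = phi @^-1` (Delta `*` I01).
    apply/seteqP; split => // t _; split; first exact: Z_simplex.
    by rewrite /= in_itv/=; exact: W01.
  apply/esym/(ge0_integral_pushforward mphi _ mDI) => //.
  by move=> z /[!inE]; exact: h0.
apply: eq_measure_integral => A mA _; apply/esym.
(* Independence is the statement that the joint law agrees with the product law on rectangles. *)
apply: (@product_measure_unique _ _ _ _ _ muZ KW (pushforward_measure Q mphi) _ A mA) => B C mB mC.
have := ZW mB mC; rewrite /= /pushforward => ->.
congr (_ * _); rewrite comp_preimage; apply: proj_law.
by have := mZ measurableT mB; rewrite setTI.
Qed.

End expectations.

Lemma size_bias_laws_of_mixture (d' : measure_display) (T' : measurableType d')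
    (Q : probability T' R) (proj : {RV Q >-> T}) (W : {RV Q >-> R}) :
  size_bias_mixture Z proj W ->
  size_bias_laws muZ (distribution Q W) (fun i => tnth (mean_vector P Z) i).
Proof.
move=> [proj_law W01 ZW _ sb] i g mg g0.
rewrite -(expectation_size_bias proj_law)// -(expectation_mixture proj_law W01 ZW)//.
by apply: sb => //; exact: measurable_funTS.
Qed.

(** The enlarged space is [T * R] with the product of [P] and [K], the two projections giving the
    old space and, up to clamping, [W]. *)
Lemma mixture_of_size_bias_laws (K : probability R R) : K I01 = 1 ->
  (0 < remainder_moment K 1 < 1)%R ->
  size_bias_laws muZ K (fun i => tnth (mean_vector P Z) i) ->
  exists (d' : measure_display) (T' : measurableType d') (Q : probability T' R)
     (proj : {RV Q >-> T}) (W : {RV Q >-> R}), size_bias_mixture Z proj W.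
Proof.
move=> KI c01 sb.
pose Q : probability (T * R)%type R := P \x K.
have mfst : measurable_fun [set: T * R] (@fst T R) by exact: measurable_fst.
(* [W] must take its values in [[0, 1]] everywhere, while [K] is only concentrated there; clamping
   does not change the law. *)
pose clamp (w : R) : R := Num.max 0%R (Num.min 1%R w).
have mclamp : measurable_fun setT clamp.
  by apply: measurable_maxr => //; exact: measurable_minr.
have clamp01 w : (0 <= clamp w <= 1)%R.
  by rewrite /clamp le_max lexx/= ge_max ler01 ge_min lexx.
have clamp_id w : I01 w -> clamp w = w.
  rewrite /= in_itv/= => /andP[w0 w1]; rewrite /clamp.
  by rewrite (min_idPr w1) (max_idPr w0).
have mW : measurable_fun [set: T * R] (clamp \o @snd T R).
  by apply: measurableT_comp => //; exact: measurable_snd.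
pose proj_mixin := isMeasurableFun.Build _ _ _ _ _ mfst.
pose proj : {RV Q >-> T} := HB.pack (@fst T R) proj_mixin.
pose W_mixin := isMeasurableFun.Build _ _ _ _ _ mW.
pose W : {RV Q >-> R} := HB.pack (clamp \o @snd T R) W_mixin.
have mpre (A : set R) : measurable A -> measurable (clamp @^-1` A).
  by move=> mA; rewrite -[X in measurable X]setTI; exact: mclamp.
have QX (A : set T) (B : set R) : measurable A -> measurable B ->
    Q (A `*` B) = P A * K B.
  by move=> mA mB; rewrite /Q /= product_measure1E.
have proj_law : has_law proj P.
  move=> A mA; rewrite /= /distribution /pushforward.
  rewrite (_ : _ @^-1` _ = A `*` setT); first by rewrite QX// probability_setT mule1.
  by apply/seteqP; split => [z|z []] //=.
have W01 t : (0 <= W t <= 1)%R by exact: clamp01.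
have preW (A : set R) : W @^-1` A = setT `*` (clamp @^-1` A).
  by apply/seteqP; split => [z|z []] //=.
have ZW : independent Q (Z \o proj) W.
  move=> A B mA mB.
  have mZA : measurable (Z @^-1` A) by rewrite -[X in measurable X]setTI; exact: mZ.
  have preZ : (Z \o proj) @^-1` A = (Z @^-1` A) `*` setT.
    by apply/seteqP; split => [z|z []] //=.
  rewrite preZ preW -setXI setTI setIT.
  rewrite !QX//; [|exact: mpre..].
  by rewrite !probability_setT mule1 mul1e.
have KE A : measurable A -> distribution Q W A = K A.
  move=> mA; rewrite /= /distribution /pushforward preW QX//; last exact: mpre.
  rewrite probability_setT mul1e.
  have KC : K (~` I01) = 0 by rewrite probability_setC// KI subee.
  have KI' B : measurable B -> K B = K (B `&` I01).
    move=> mB; rewrite -{1}(setIT B) -(setUv I01) setIUr measureU0//.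
    - exact: measurableI.
    - by apply: measurableI => //; exact: measurableC.
    - apply: (@subset_measure0 _ _ _ K _ (~` I01)) => //.
      + by apply: measurableI => //; exact: measurableC.
      + exact: measurableC.
  rewrite KI'; last exact: mpre.
  rewrite [RHS]KI'//; congr (K _).
  by apply/seteqP; split => w /= [wA wI]; move: wA; rewrite clamp_id.
have remE : remainder_moment (distribution Q W) 1 = remainder_moment K 1.
  by congr fine; apply: eq_measure_integral => A mA _; exact: KE.
exists _, _, Q, proj, W; split => //.
  rewrite expectation_remainder// remE lte_fin [X in _ && X]lte_fin.
  by rewrite subr_gt0 ltrBlDr ltrDl andbC.
(* The given [g] is controlled only on the cube, so it is extended by 0; all vectors at hand stay in
   the simplex. *)
move=> i g mg g0; pose g' := g \_ (@unit_cube R n).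
have mcube := @measurable_unit_cube R n.
have mg' : measurable_fun setT g' by apply/(measurable_restrictT g).
have g'E x : unit_cube x -> g' x = g x by move=> x01; rewrite /g' patchE mem_set.
have g'0 x : unit_cube x -> (0 <= g' x)%R by move=> x01; rewrite g'E// g0.
transitivity ('E_Q[fun t => (g' (Z (proj t)) * tnth (Z (proj t)) i)%R]).
  congr ('E_Q[_]); apply/funext => t; rewrite g'E//.
  by have [] := Z_simplex (proj t).
rewrite (expectation_size_bias proj_law)// sb//; congr (_ * _).
transitivity ('E_Q[fun t => g' (move_towards i (W t) (Z (proj t)))]).
  rewrite (expectation_mixture proj_law W01 ZW)//.
  apply: eq_integral => x _; apply: eq_measure_integral => A mA _.
  by apply/esym; exact: KE.
congr ('E_Q[_]); apply/funext => t; rewrite g'E//.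
by have [] := stdsimplex_move i (W01 t) (Z_simplex (proj t)).
Qed.

End mixtures.

Section beta_remainder.
Context (R : realType).
Local Open Scope ereal_scope.

Lemma beta_remainder_moment (K : probability R R) (al : R) : (0 < al)%R ->
  (forall l r : nat, \int[K]_(w in `[0%R, 1%R]) (w ^+ l * (1 - w) ^+ r)%:E =
     (rising 1 l * rising al r / rising (1 + al) (l + r))%:E) ->
  remainder_moment K 1 = (al / (1 + al))%R.
Proof.
move=> al0 KM; apply: EFin_inj; rewrite EFin_remainder_moment.
transitivity (\int[K]_(w in `[0%R, 1%R]) (w ^+ 0 * (1 - w) ^+ 1)%:E).
  by apply: eq_integral => w _; rewrite expr0 mul1r.
by rewrite KM !risingS !rising0 !addr0 !mul1r.
Qed.

End beta_remainder.

Theorem theorem5p1 (R : realType) (n : nat) (d : measure_display)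
    (T : measurableType d) (P : probability T R) (Z : {RV P >-> n.-tuple R})
    (Z_simplex : forall t, stdsimplex (Z t))
    (p := mean_vector P Z) (p_good : good p) :
  (has_dirichlet_law Z <->
   exists (d' : measure_display) (T' : measurableType d') (Q : probability T' R)
     (proj : {RV Q >-> T}) (W : {RV Q >-> R}), size_bias_mixture Z proj W) /\
  (forall (d' : measure_display) (T' : measurableType d')
     (Q : probability T' R) (proj : {RV Q >-> T}) (W : {RV Q >-> R}),
     size_bias_mixture Z proj W ->
     let m := fine ('E_Q[W])%E in
     let alpha := (1 - m) / m in
     has_law W (beta_law 1 alpha) /\
     has_law Z (dirichlet [tuple alpha * tnth p i | i < n])).
Proof.
have [p0 p1] := mean_vector_simplex Z_simplex; rewrite -/p in p0 p1.
have paramE alpha : \sum_(i < n) tnth [tuple alpha * tnth p i | i < n] i = alpha.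
  by under eq_bigr do rewrite tnth_mktuple; rewrite -mulr_sumr p1 mulr1.
have param alpha : 0 < alpha ->
    dirichlet_parameter [tuple alpha * tnth p i | i < n].
  move=> al0; split=> [i|]; last by rewrite paramE.
  by rewrite tnth_mktuple mulr_ge0// ltW.
have mean_mixture d' (T' : measurableType d') (Q : probability T' R)
    (proj : {RV Q >-> T}) (W : {RV Q >-> R}) : size_bias_mixture Z proj W ->
    let m := fine ('E_Q[W])%E in
    0 < m < 1 /\ remainder_moment (distribution Q W) 1 = 1 - m.
  move=> [_ W01 _ + _]; rewrite expectation_remainder//= !lte_fin => ->.
  by split => //; rewrite subKr.
have laws d' (T' : measurableType d') (Q : probability T' R)
     (proj : {RV Q >-> T}) (W : {RV Q >-> R}) : size_bias_mixture Z proj W ->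
     let m := fine ('E_Q[W])%E in
     let alpha := (1 - m) / m in
     has_law W (beta_law 1 alpha) /\
     has_law Z (dirichlet [tuple alpha * tnth p i | i < n]).
  move=> mix; have [m01 rem] := mean_mixture _ _ _ _ _ mix.
  move=> m alpha; rewrite -/m in m01 rem; have /andP[m0 m1] := m01.
  have al0 : 0 < alpha by rewrite divr_gt0 ?subr_gt0.
  (* The comparison pair has the same means: [E (1 - W)] is [alpha / (1 + alpha)] for the beta law,
     which is [1 - m] by the choice of [alpha]. *)
  have [mu' [mu'E mu'D mu'M]] := dirichlet_moments (param _ al0).
  have [K' [K'E K'I K'M]] := beta_law_moments ltr01 al0.
  have sb' : size_bias_laws mu' K' (fun i => tnth p i).
    have -> : (fun i => tnth p i) = (fun i => tnth [tuple alpha * tnth p i | i < n] i /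
        \sum_(i < n) tnth [tuple alpha * tnth p i | i < n] i).
      by apply/funext => i; rewrite paramE tnth_mktuple mulrAC divff ?mul1r ?gt_eqF.
    apply: dirichlet_beta_size_bias mu'M _; first exact: param.
    by move=> l r; rewrite paramE K'M.
  have sb := size_bias_laws_of_mixture Z_simplex mix.
  have ZD := distribution_simplex Z_simplex.
  have WI : distribution Q W `[0, 1]%classic = 1%E.
    by have [_ W01 _ _ _] := mix; exact: distribution_unit_interval.
  have [B [pB pB2]] := p_good.
  have c0 : 0 < remainder_moment (distribution Q W) 1 by rewrite rem subr_gt0.
  have cc' : remainder_moment K' 1 = remainder_moment (distribution Q W) 1.
    rewrite rem (beta_remainder_moment al0 K'M) /alpha; field.
    by rewrite addrC subrK oner_eq0 gt_eqF.
  split=> A mA.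
    rewrite -K'E//.
    exact: (size_bias_laws_unique_remainder sb sb' ZD mu'D WI K'I p1 pB pB2 c0 cc').
  rewrite -mu'E//.
  exact: (size_bias_laws_unique sb sb' ZD mu'D WI K'I p1 pB pB2 c0 cc').
split; last exact: laws.
split; last first.
  move=> [d' [T' [Q [proj [W mix]]]]].
  have [_ ZD] := laws _ _ _ _ _ mix.
  have [/andP[m0 m1] _] := mean_mixture _ _ _ _ _ mix.
  exists [tuple (1 - fine 'E_Q[W]) / fine 'E_Q[W] * tnth p i | i < n] => //.
  by apply: param; rewrite divr_gt0 ?subr_gt0.
(* [W] is given the law [Beta(1, al)], where [al] is the total parameter of the law of [Z]. *)
move=> [a aP aZ]; set al := \sum_(i < n) tnth a i.
have [a0 al0] : (forall i, 0 <= tnth a i) /\ 0 < al := aP.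
have [mu [muE _ muM]] := dirichlet_moments aP.
have [K [_ KI KM]] := beta_law_moments ltr01 al0.
have ZM e : (\int[distribution P Z]_(x in @stdsimplex R n) (monomial e x)%:E =
    ((\prod_(i < n) rising (tnth a i) (e i)) / rising al (\sum_(i < n) e i))%:E)%E.
  by rewrite -muM; apply: eq_measure_integral => A mA _; exact: etrans (aZ A mA) (esym (muE A mA)).
(* The mean is the moment with exponent 1 at [i] and 0 elsewhere. *)
have pE : (fun i => tnth p i) = (fun i => tnth a i / al).
  apply/funext => i; apply: EFin_inj; rewrite mean_vectorE//.
  pose e (j : 'I_n) : nat := (j == i).
  transitivity (\int[distribution P Z]_(x in @stdsimplex R n) (monomial e x)%:E)%E.
    apply: eq_integral => x _; rewrite /monomial (bigD1 i)//= /e eqxx expr1 big1 ?mulr1//.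
    by move=> j /negbTE ->.
  rewrite ZM; congr ((_ / _)%:E).
    rewrite (bigD1 i)//= /e eqxx risingS rising0 mul1r addr0 big1 ?mulr1//.
    by move=> j /negbTE ->; rewrite rising0.
  rewrite (bigD1 i)//= /e eqxx big1 => [|j /negbTE ->]//.
  by rewrite addn0 risingS rising0 mul1r addr0.
apply: (mixture_of_size_bias_laws Z_simplex KI).
  rewrite (beta_remainder_moment al0 KM).
  have al1 : 0 < 1 + al by rewrite addr_gt0.
  by rewrite divr_gt0//= ltr_pdivrMr// mul1r ltrDr.
by rewrite -/p pE; exact: dirichlet_beta_size_bias.
Qed.
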